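(* Let $\Gamma_1$ and $\Gamma_2$ be finitely generated residually finite groups, and let $\Phi:\widehat{\Gamma_1}\to\widehat{\Gamma_2}$ be a bi-semiauthentic isomorphism. Let $n\in\mathbb{N}$. Then, for any algebraically closed field $F$ of characteristic zero, $\Phi$ induces an algebraic isomorphism $\Phi^*:X_n(\Gamma_2,F)\to X_n(\Gamma_1,F)$; that is, the algebraic map $\Phi^*$ induced by the semiauthentic homomorphism $\Phi$ is an isomorphism of affine algebraic sets.
   Context: Residually finite groups are identified with their images in their profinite completions. A homomorphism $\Phi:\widehat{\Gamma_1}\to\widehat{\Gamma_2}$ (with $\Gamma_1,\Gamma_2$ finitely generated residually finite) is semiauthentic if there is a semigroup $S\subseteq\Gamma_1$ which generates $\Gamma_1$ as a group, such that for each $s\in S$, $\Phi(s)$ is conjugate in $\widehat{\Gamma_2}$ to an element of $\Gamma_2$. An isomorphism $\Phi$ is bi-semiauthentic if both $\Phi$ and $\Phi^{-1}$ are semiauthentic. For a finitely generated group $\Gamma$ and an algebraically closed field $F$ of characteristic zero, $R_n(\Gamma,F)=\mathrm{Hom}(\Gamma,\mathrm{SL}_n(F))$ is the representation variety, and $X_n(\Gamma,F)=R_n(\Gamma,F)/\!/\mathrm{SL}_n(F)=\mathrm{MaxSpec}\big(F[R_n(\Gamma,F)]^{\mathrm{SL}_n(F)}\big)$ is the $\mathrm{SL}_n(F)$-character variety (an affine algebraic set, possibly reducible). For $\gamma\in\Gamma$, $\mathrm{tr}_\gamma\in F[X_n(\Gamma,F)]$ is the function $\mathrm{tr}_\gamma(\rho)=\mathrm{tr}(\rho(\gamma))$.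 The algebraic map $\Phi^*:X_n(\Gamma_2,F)\to X_n(\Gamma_1,F)$ induced by a semiauthentic homomorphism $\Phi$ is characterized as follows: if $S\subseteq\Gamma_1$ is a semigroup generating $\Gamma_1$ as a group and for each $s\in S$ the element $\Phi(s)$ is conjugate in $\widehat{\Gamma_2}$ to $\widetilde s\in\Gamma_2$, then the assignment $\mathrm{tr}_s\mapsto\mathrm{tr}_{\widetilde s}$ ($s\in S$) extends uniquely to a homomorphism of $F$-algebras $\Phi^\sharp:F[X_n(\Gamma_1,F)]\to F[X_n(\Gamma_2,F)]$, which is independent of the choice of $S$, and $\Phi^*$ is the corresponding map of maximal ideal spectra. *)

(* Defs.v *)
From HB Require Import structures.
From mathcomp Require Import all_boot all_order all_algebra.
From mathcomp Require Import all_classical.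
Set Implicit Arguments.
Unset Strict Implicit.
Unset Printing Implicit Defensive.
Import GRing.Theory.
Local Open Scope classical_set_scope.
Local Open Scope group_scope.

Section Groups.
Variable G : groupType.
Implicit Types (H S : set G) (x y g : G).

Definition is_subgroup H : Prop :=
  [/\ H 1, forall x y, H x -> H y -> H (x * y) & forall x, H x -> H x^-1].

Definition generates S : Prop :=
  forall H, is_subgroup H -> S `<=` H -> H = [set: G].

Definition finitely_generated : Prop := exists s : seq G, generates [set` s].

Definition is_normal H : Prop := forall x g, H x -> H (x ^ g).

Definition lcoset_set H g : set G := [set x | H (g^-1 * x)].

Definition finite_index H : Prop :=
  exists s : seq G, forall x, exists2 g, g \in s & lcoset_set H g x.

Definition is_semigroup S : Prop := forall x y, S x -> S y -> S (x * y).

Record fin_normal := FinNormal {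
  fin_normal_set :> set G;
  fin_normal_subgroup : is_subgroup fin_normal_set;
  fin_normal_normal : is_normal fin_normal_set;
  fin_normal_index : finite_index fin_normal_set }.

Definition residually_finite : Prop :=
  forall x, x <> 1 -> exists N : fin_normal, ~ fin_normal_set N x.

(* The inverse limit of the finite quotients G / N, an element of G / N being
   a coset, i.e. a subset of G; the transition map G / N -> G / M for N `<=` M
   sends a coset of N to the coset of M which contains it. *)
Record profinite := Profinite {
  component :> fin_normal -> set G;
  component_coset : forall N, exists g, component N = lcoset_set N g;
  component_compat : forall N M : fin_normal,
    N `<=` M -> component N `<=` component M }.

Lemma profinite_eq (u v : profinite) : (forall N, u N = v N) -> u = v.
Proof.
case: u => u u1 u2; case: v => v v1 v2 /= /funext uv.
by case: _ / uv in v1 v2 *; congr Profinite; apply: Prop_irrelevance.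
Qed.

HB.instance Definition _ := gen_eqMixin profinite.
HB.instance Definition _ := gen_choiceMixin profinite.

Lemma lcoset_refl (N : fin_normal) g : lcoset_set N g g.
Proof. by rewrite /lcoset_set /= mulVg; case: (fin_normal_subgroup N). Qed.

Lemma lcoset_setM (N : fin_normal) g h :
  [set x * y | x in lcoset_set N g & y in lcoset_set N h] =
  lcoset_set N (g * h).
Proof.
have [N1 NM NV] := fin_normal_subgroup N.
apply/seteqP; split=> [_ [x /= Nx [y Ny <-]] | z /= Nz].
  rewrite /lcoset_set /=.
  have -> : (g * h)^-1 * (x * y) = ((g^-1 * x) ^ h) * (h^-1 * y).
    by rewrite /conjg invgM !mulgA mulgK.
  by apply: NM => //; apply: fin_normal_normal.
exists g; first exact: lcoset_refl.
exists (g^-1 * z); last by rewrite mulVKg.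
by move: Nz; rewrite /lcoset_set /= invgM mulgA.
Qed.

Lemma lcoset_setV (N : fin_normal) g :
  [set x^-1 | x in lcoset_set N g] = lcoset_set N g^-1.
Proof.
have [N1 NM NV] := fin_normal_subgroup N.
apply/seteqP; split=> [_ [x /= Nx <-] | z /= Nz].
  rewrite /lcoset_set /= invgK.
  have -> : g * x^-1 = ((g^-1 * x)^-1) ^ g^-1.
    by rewrite /conjg invgM !invgK !mulgA mulgK.
  by apply: fin_normal_normal; apply: NV.
exists z^-1; last by rewrite invgK.
rewrite /lcoset_set /= invgK in Nz; rewrite /lcoset_set /=.
have -> : g^-1 * z^-1 = ((g * z)^-1) ^ g.
  by rewrite /conjg invgM -!mulgA mulVg mulg1.
by apply: fin_normal_normal; apply: NV.
Qed.

Lemma lcoset_compat g (N M : fin_normal) :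
  N `<=` M -> lcoset_set N g `<=` lcoset_set M g.
Proof. by move=> NM x; apply: NM. Qed.

Definition to_profinite (g : G) : profinite :=
  Profinite (fun N => ex_intro _ g erefl) (@lcoset_compat g).

Definition profinite_mul_set (u v : profinite) (N : fin_normal) : set G :=
  [set x * y | x in u N & y in v N].

Fact profinite_mul_coset u v N :
  exists g, profinite_mul_set u v N = lcoset_set N g.
Proof.
have [g ug] := component_coset u N; have [h vh] := component_coset v N.
by exists (g * h); rewrite /profinite_mul_set ug vh lcoset_setM.
Qed.

Fact profinite_mul_compat u v (N M : fin_normal) :
  N `<=` M -> profinite_mul_set u v N `<=` profinite_mul_set u v M.
Proof.
move=> NM _ [x ux [y vy <-]]; exists x; first exact: (component_compat NM).
by exists y => //; exact: (component_compat NM).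
Qed.

Definition profinite_mul (u v : profinite) : profinite :=
  Profinite (profinite_mul_coset u v) (@profinite_mul_compat u v).

Definition profinite_inv_set (u : profinite) (N : fin_normal) : set G :=
  [set x^-1 | x in u N].

Fact profinite_inv_coset u N :
  exists g, profinite_inv_set u N = lcoset_set N g.
Proof.
have [g ug] := component_coset u N.
by exists g^-1; rewrite /profinite_inv_set ug lcoset_setV.
Qed.

Fact profinite_inv_compat u (N M : fin_normal) :
  N `<=` M -> profinite_inv_set u N `<=` profinite_inv_set u M.
Proof.
by move=> NM _ [x ux <-]; exists x => //; exact: (component_compat NM).
Qed.

Definition profinite_inv (u : profinite) : profinite :=
  Profinite (profinite_inv_coset u) (@profinite_inv_compat u).

Fact profinite_mulA : associative profinite_mul.
Proof.
move=> u v w; apply: profinite_eq => N /=; rewrite /profinite_mul_set /= /profinite_mul_set.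
have [a ->] := component_coset u N; have [b ->] := component_coset v N.
have [c ->] := component_coset w N.
by rewrite !lcoset_setM mulgA.
Qed.

Fact profinite_mul1 : left_id (to_profinite 1) profinite_mul.
Proof.
move=> u; apply: profinite_eq => N /=; rewrite /profinite_mul_set /=.
by have [a ->] := component_coset u N; rewrite lcoset_setM mul1g.
Qed.

Fact profinite_mulr1 : right_id (to_profinite 1) profinite_mul.
Proof.
move=> u; apply: profinite_eq => N /=; rewrite /profinite_mul_set /=.
by have [a ->] := component_coset u N; rewrite lcoset_setM mulg1.
Qed.

Fact profinite_mulV : left_inverse (to_profinite 1) profinite_inv profinite_mul.
Proof.
move=> u; apply: profinite_eq => N /=.
rewrite /profinite_mul_set /= /profinite_inv_set.
by have [a ->] := component_coset u N; rewrite lcoset_setV lcoset_setM mulVg.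
Qed.

Fact profinite_mulrV :
  right_inverse (to_profinite 1) profinite_inv profinite_mul.
Proof.
move=> u; apply: profinite_eq => N /=.
rewrite /profinite_mul_set /= /profinite_inv_set.
by have [a ->] := component_coset u N; rewrite lcoset_setV lcoset_setM mulgV.
Qed.

HB.instance Definition _ := isGroup.Build profinite
  profinite_mulA profinite_mul1 profinite_mulr1 profinite_mulV profinite_mulrV.

Fact to_profiniteM : {morph to_profinite : x y / x * y}.
Proof.
by move=> x y; apply: profinite_eq => N; rewrite /= /profinite_mul_set lcoset_setM.
Qed.

HB.instance Definition _ :=
  isMultiplicative.Build G profinite to_profinite to_profiniteM.

End Groups.

Section Semiauthentic.
Variables G1 G2 : groupType.
Implicit Types (S : set G1) (Phi : {multiplicative profinite G1 -> profinite G2}).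

Definition conjugate_to (G : groupType) (u v : profinite G) : Prop :=
  exists w, u ^ w = v.

Definition semiauthentic_via Phi S (st : G1 -> G2) : Prop :=
  [/\ is_semigroup S, generates S &
      forall s, S s -> conjugate_to (Phi (to_profinite s)) (to_profinite (st s))].

Definition semiauthentic Phi : Prop :=
  exists S, [/\ is_semigroup S, generates S &
    forall s, S s ->
      exists t : G2, conjugate_to (Phi (to_profinite s)) (to_profinite t)].

End Semiauthentic.

(* Group homomorphisms are automatically unital, so [Phi] is an isomorphism with
   inverse [Psi]. *)
Definition bi_semiauthentic_isomorphism (G1 G2 : groupType)
    (Phi : {multiplicative profinite G1 -> profinite G2}) : Prop :=
  exists Psi : {multiplicative profinite G2 -> profinite G1},
    [/\ cancel Phi Psi, cancel Psi Phi, semiauthentic Phi & semiauthentic Psi].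

Local Open Scope ring_scope.

Section CharacterVariety.
Variables (F : closedFieldType) (n : nat) (G : groupType).

(* R_n(G, F) = Hom(G, SL_n(F)); a multiplicative map of groups is unital. *)
Record SLrep := SLRep {
  SLrep_fun :> G -> 'M[F]_n;
  SLrep_det : forall x, \det (SLrep_fun x) = 1;
  SLrepM : forall x y, SLrep_fun (x * y)%g = SLrep_fun x *m SLrep_fun y }.

Definition trivial_SLrep : SLrep :=
  @SLRep (fun=> 1%:M) (fun=> det1 F n) (fun _ _ => esym (mul1mx 1%:M)).

HB.instance Definition _ := gen_eqMixin SLrep.
HB.instance Definition _ := gen_choiceMixin SLrep.
HB.instance Definition _ := isPointed.Build SLrep trivial_SLrep.

Fact SLconj_det (g : 'M[F]_n) (rho : SLrep) x :
  \det g = 1 -> \det (g *m rho x *m invmx g) = 1.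
Proof. by move=> g1; rewrite !det_mulmx det_inv g1 SLrep_det invr1 !mulr1. Qed.

Fact SLconjM (g : 'M[F]_n) (rho : SLrep) x y : \det g = 1 ->
  g *m rho (x * y)%g *m invmx g =
  (g *m rho x *m invmx g) *m (g *m rho y *m invmx g).
Proof.
move=> g1; have gu : g \in unitmx by rewrite unitmxE g1 unitr1.
by rewrite SLrepM !mulmxA mulmxKV.
Qed.

Definition SLconj (g : 'M[F]_n) (g1 : \det g = 1) (rho : SLrep) : SLrep :=
  SLRep (fun x => SLconj_det rho x g1) (fun x y => SLconjM rho x y g1).

(* F[R_n(G, F)], as an algebra of F-valued functions on R_n(G, F): it is
   generated by the matrix entries of rho x, for x in G.  If G is generated by
   x_1, ..., x_k, then, as the entries of an inverse in SL_n are polynomials, these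
   are the polynomial functions on R_n(G, F), viewed as an algebraic subset of
   SL_n(F)^k. *)
Inductive regular : (SLrep -> F) -> Prop :=
| regular_cst c : regular (fun=> c)
| regular_entry x i j : regular (fun rho => rho x i j)
| regularD f g : regular f -> regular g -> regular (fun rho => f rho + g rho)
| regularM f g : regular f -> regular g -> regular (fun rho => f rho * g rho).

Definition SLinvariant (f : SLrep -> F) : Prop :=
  forall g (g1 : \det g = 1) rho, f (SLconj g1 rho) = f rho.

Definition charfun_pred : {pred (SLrep -> F)} :=
  fun f => `[< regular f /\ SLinvariant f >].

Fact charfun_subring : subring_closed charfun_pred.
Proof.
split=> [|f h /asboolP[rf vf] /asboolP[rh vh]
         |f h /asboolP[rf vf] /asboolP[rh vh]]; apply/asboolP.
- by split=> //; exact: (regular_cst 1).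
- have -> : f - h = fun rho => f rho + (-1) * h rho.
    by apply/funext => rho; rewrite mulN1r.
  split=> [|g g1 rho]; last by rewrite vf vh.
  by apply: regularD => //; apply: (regularM (regular_cst (-1))).
- split=> [|g g1 rho]; first exact: (regularM rf rh).
  by rewrite [LHS]/(f _ * h _) vf vh.
Qed.

HB.instance Definition _ :=
  GRing.isSubringClosed.Build (SLrep -> F) charfun_pred charfun_subring.

(* F[X_n(G, F)] = F[R_n(G, F)]^(SL_n(F)), with pointwise operations. *)
Record charfun := CharFun {
  charfun_val :> SLrep -> F;
  charfunP : charfun_val \in charfun_pred }.

HB.instance Definition _ := [isSub for charfun_val].
HB.instance Definition _ := [Choice of charfun by <:].
HB.instance Definition _ := [SubChoice_isSubComNzRing of charfun by <:].

Fact charfun_cstP (c : F) : (fun=> c) \in charfun_pred.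
Proof. by apply/asboolP; split=> //; exact: regular_cst. Qed.

Definition charfun_cst (c : F) : charfun := CharFun (charfun_cstP c).

Definition charfun_scale (c : F) (f : charfun) : charfun := charfun_cst c * f.

Fact charfun_scaleA a b f :
  charfun_scale a (charfun_scale b f) = charfun_scale (a * b) f.
Proof. by rewrite /charfun_scale mulrA; congr (_ * _); apply: val_inj. Qed.

Fact charfun_scale1 : left_id 1 charfun_scale.
Proof.
move=> f; rewrite /charfun_scale -[RHS]mul1r; congr (_ * _).
exact: val_inj.
Qed.

Fact charfun_scaleDr : right_distributive charfun_scale +%R.
Proof. by move=> a f g; rewrite /charfun_scale mulrDr. Qed.

Fact charfun_scaleDl f : {morph charfun_scale^~ f : a b / a + b}.
Proof.
move=> a b; rewrite /charfun_scale -mulrDl; congr (_ * _).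
exact: val_inj.
Qed.

HB.instance Definition _ := GRing.Zmodule_isLmodule.Build F charfun
  charfun_scaleA charfun_scale1 charfun_scaleDr charfun_scaleDl.

Fact charfun_scaleAl (a : F) (f g : charfun) : a *: (f * g) = a *: f * g.
Proof. exact: mulrA. Qed.

HB.instance Definition _ :=
  GRing.Lmodule_isLalgebra.Build F charfun charfun_scaleAl.

Fact charfun_scaleAr (a : F) (f g : charfun) : a *: (f * g) = f * (a *: g).
Proof. exact: mulrCA. Qed.

HB.instance Definition _ :=
  GRing.Lalgebra_isAlgebra.Build F charfun charfun_scaleAr.

Fact charfun_traceP x : (fun rho : SLrep => \tr (rho x)) \in charfun_pred.
Proof.
apply/asboolP; split=> [|g g1 rho /=].
  rewrite /mxtrace; elim: (index_enum _) => [|i r IHr].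
    rewrite (_ : (fun _ => _) = fun=> 0); first exact: regular_cst.
    by apply/funext => rho; rewrite big_nil.
  rewrite (_ : (fun _ => _) = fun rho : SLrep =>
    rho x i i + \sum_(j <- r) rho x j j); last first.
    by apply/funext => rho; rewrite big_cons.
  by apply: regularD => //; exact: regular_entry.
have gu : g \in unitmx by rewrite unitmxE g1 unitr1.
by rewrite mxtrace_mulC mulmxA mulVmx // mul1mx.
Qed.

Definition charfun_trace (x : G) : charfun := CharFun (charfun_traceP x).

End CharacterVariety.

Section MaxSpec.

Definition is_ideal (A : comNzRingType) (I : set A) : Prop :=
  [/\ I 0, forall a b, I a -> I b -> I (a + b) & forall a b, I b -> I (a * b)].

Definition is_maximal_ideal (A : comNzRingType) (m : set A) : Prop :=
  [/\ is_ideal m, ~ m 1 &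
      forall I, is_ideal I -> ~ I 1 -> m `<=` I -> I = m].

Record MaxSpec (A : comNzRingType) := MaximalIdeal {
  maximal_set :> set A;
  maximal_setP : is_maximal_ideal maximal_set }.

Variables (F : fieldType) (A B : comAlgType F).

(* The map of maximal spectra corresponding to an algebra morphism is given by
   taking preimages. *)
Definition spec_map_of (f : {lrmorphism A -> B}) (u : MaxSpec B -> MaxSpec A) :
  Prop := forall m : MaxSpec B, u m = f @^-1` m :> set A.

Definition algebraic_map (u : MaxSpec B -> MaxSpec A) : Prop :=
  exists f : {lrmorphism A -> B}, spec_map_of f u.

End MaxSpec.

Definition algebraic_isomorphism (F : fieldType) (A B : comAlgType F)
    (u : MaxSpec B -> MaxSpec A) : Prop :=
  algebraic_map u /\
  exists v : MaxSpec A -> MaxSpec B, [/\ algebraic_map v, cancel u v & cancel v u].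

Definition character_variety (F : closedFieldType) (n : nat) (G : groupType) :=
  MaxSpec (charfun F n G).

(* [Phi_sharp] is, for every admissible semigroup [S] and every choice of the
   elements [st s], the unique extension of tr_s |-> tr_(st s). *)
Definition induced_comorphism (F : closedFieldType) (n : nat) (G1 G2 : groupType)
    (Phi : {multiplicative profinite G1 -> profinite G2})
    (Phi_sharp : {lrmorphism charfun F n G1 -> charfun F n G2}) : Prop :=
  forall (S : set G1) (st : G1 -> G2), semiauthentic_via Phi S st ->
    (forall s, S s ->
       Phi_sharp (charfun_trace F n s) = charfun_trace F n (st s)) /\
    (forall f : {lrmorphism charfun F n G1 -> charfun F n G2},
       (forall s, S s -> f (charfun_trace F n s) = charfun_trace F n (st s)) ->
       f =1 Phi_sharp).

Definition induced_map (F : closedFieldType) (n : nat) (G1 G2 : groupType)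
    (Phi : {multiplicative profinite G1 -> profinite G2})
    (Phi_star : character_variety F n G2 -> character_variety F n G1) : Prop :=
  exists Phi_sharp : {lrmorphism charfun F n G1 -> charfun F n G2},
    induced_comorphism Phi Phi_sharp /\ spec_map_of Phi_sharp Phi_star.

(* Main.v *)
From HB Require Import structures.
Require Import Defs.
From mathcomp Require Import all_boot all_order all_algebra all_field.
From mathcomp Require Import all_classical.
From mathcomp Require Import zify ring.

(* (1) For a semigroup S generating G, every invariant regular function on
   R_n(G, F) is a polynomial in the tr_s, s in S.  The derivations D_ab induced
   by the elementary matrices act on monomials in matrix entries; the Casimir
   operator sum_ab D_ab D_ba kills invariants, while modulo traces and
   monomials of lower degree it acts on monomials of degree
   d > 0 by a symmetric integer matrix which is positive definite.  By
   Cayley-Hamilton an invariant of degree d is therefore of degree d - 1 over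
   the algebra of traces, and one descends to degree 0.
   (2) For rho : G2 -> SL_n(F) there is rho' : G1 -> SL_n(F) such that
   tr rho'(s) = tr rho(t) whenever Phi(s) is conjugate to t.  Let A be the ring
   generated by the entries of rho.  Reductions of rho along homomorphisms from
   A to algebraic closures of prime fields have finite image, hence extend to
   the profinite completion and can be composed with Phi.  There are enough such
   homomorphisms for A to embed in an ultraproduct of the residue fields; this
   gives a representation of G1 over a field containing A, which is specialised
   to F over A.
   (3) Hence f |-> (rho |-> f(rho')) is the comorphism of Phi, and those of Phi
   and of its inverse are mutually inverse since they are so on traces. *)

Set Implicit Arguments.
Unset Strict Implicit.
Unset Printing Implicit Defensive.
Import GRing.Theory Num.Theory.

(** * Finite representations and the profinite completion *)

Section LinearRep.
Local Open Scope ring_scope.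

Definition is_SLrep (R : comNzRingType) n (G : groupType) (M : G -> 'M[R]_n) :=
  (forall x, \det (M x) = 1) /\ (forall x y, M (x * y)%g = M x *m M y).

Lemma SLrep_is_SLrep (F : closedFieldType) n (G : groupType) (rho : SLrep F n G) :
  is_SLrep rho.
Proof. by split; [apply: SLrep_det | apply: SLrepM]. Qed.

Section Basic.
Variables (R : comNzRingType) (n : nat) (G : groupType) (M : G -> 'M[R]_n).
Hypothesis repM : is_SLrep M.

Lemma is_SLrep1 : M 1%g = 1%:M.
Proof.
case: repM => d m; have H := mul_adj_mx (M 1%g); rewrite d in H.
have := mulmxA (\adj (M 1%g)) (M 1%g) (M 1%g); rewrite -m mulg1 mul_adj_mx d.
by rewrite mul1mx => ->.
Qed.

Lemma is_SLrepV x : M x^-1%g = \adj (M x).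
Proof.
case: (repM) => d m.
rewrite -[RHS]mulmx1 -is_SLrep1 -(mulgV x) m mulmxA mul_adj_mx.
by rewrite d mul1mx.
Qed.

(** The elements of [G] whose matrices have all entries in [P] form a subgroup, since a matrix of
    determinant one is inverted by its adjugate. *)
Lemma entries_in_subring (P : R -> Prop) (xs : seq G) :
  P 1 -> (forall a b, P a -> P b -> P (a - b)) ->
  (forall a b, P a -> P b -> P (a * b)) ->
  generates [set` xs] -> (forall x i j, x \in xs -> P (M x i j)) ->
  forall x i j, P (M x i j).
Proof.
move=> P1 PB PM gen Pxs; case: repM => d m.
have P0 : P 0 by rewrite -(subrr 1); apply: PB.
have PN a : P a -> P (- a) by rewrite -sub0r; apply: PB.
have PD a b : P a -> P b -> P (a + b) by move=> Pa Pb; rewrite -[b]opprK; apply/PB/PN.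
have Psum I (r : seq I) (f : I -> R) : (forall i, P (f i)) -> P (\sum_(i <- r) f i).
  by move=> Pf; elim/big_ind: _.
have Pprod I (r : seq I) (f : I -> R) : (forall i, P (f i)) -> P (\prod_(i <- r) f i).
  by move=> Pf; elim/big_ind: _.
have Psign k : P ((-1) ^+ k).
  by elim: k => [|k IH]; rewrite ?expr0 // exprS mulN1r; apply: PN.
pose H : set G := fun x => forall i j, P (M x i j).
suff HT : H = setT by move=> x i j; have : H x by rewrite HT.
apply: gen => [|x /= xxs i j]; last exact: Pxs.
split=> [i j|x y Hx Hy i j|x Hx i j].
- by rewrite is_SLrep1 mxE; case: eqP.
- by rewrite m mxE; apply: (Psum) => k; apply: PM.
rewrite is_SLrepV mxE; apply: (PM) => //; apply: Psum => s; apply: PM => //.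
by apply: Pprod => k; rewrite !mxE; apply: Hx.
Qed.

End Basic.

Section ProfiniteExtension.
Variables (R : comNzRingType) (n : nat) (G : groupType) (M : G -> 'M[R]_n).
Hypothesis repM : is_SLrep M.
Hypothesis finM : exists s : seq G, forall x, exists2 g, g \in s & M x = M g.

Let K : set G := fun x => M x = 1%:M.

Let K_subgroup : is_subgroup K.
Proof.
case: (repM) => d m; split; first exact: is_SLrep1.
  by move=> x y Kx Ky; rewrite /K m Kx Ky mul1mx.
by move=> x Kx; rewrite /K is_SLrepV // Kx adj1.
Qed.

Let K_normal : is_normal K.
Proof.
case: (repM) => d m x g Kx.
by rewrite /K /conjg !m Kx mul1mx -m mulVg is_SLrep1.
Qed.

Let lcosetK g x : lcoset_set K g x <-> M x = M g.
Proof.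
case: (repM) => d m; rewrite /lcoset_set /K /= m; split=> [E|->].
  by rewrite -[LHS]mul1mx -(is_SLrep1 repM) -(mulgV g) m -mulmxA E mulmx1.
by rewrite -m mulVg is_SLrep1.
Qed.

Let K_index : finite_index K.
Proof.
have [s sP] := finM; exists s => x; have [g gs E] := sP x.
by exists g => //; apply/lcosetK.
Qed.

Let N := FinNormal K_subgroup K_normal K_index.

(** The kernel [N] of [M] has finite index because the image is finite. The component of [u] at [N]
    is a coset of [N], and [M] is constant on it. *)
Definition profinite_rep (u : profinite G) : 'M[R]_n :=
  M (projT1 (cid (component_coset u N))).

Lemma profinite_repE (u : profinite G) g :
  u N = lcoset_set N g -> profinite_rep u = M g.
Proof.
move=> ug; rewrite /profinite_rep; case: cid => h /= uh.
by apply/lcosetK; move: (lcoset_refl N h); rewrite -uh ug.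
Qed.

Lemma profinite_rep_to g : profinite_rep (to_profinite g) = M g.
Proof. exact: profinite_repE. Qed.

Lemma profinite_repM u v :
  profinite_rep (u * v)%g = profinite_rep u *m profinite_rep v.
Proof.
have [g ug] := component_coset u N; have [h vh] := component_coset v N.
rewrite (profinite_repE ug) (profinite_repE vh) -repM.2.
by apply: profinite_repE; rewrite /= /profinite_mul_set ug vh lcoset_setM.
Qed.

Lemma profinite_rep_SLrep : is_SLrep profinite_rep.
Proof. by split; [move=> u; apply: repM.1 | apply: profinite_repM]. Qed.

End ProfiniteExtension.

Lemma is_SLrep_comp (R : comNzRingType) n (G H : groupType) (M : G -> 'M[R]_n)
    (f : H -> G) : (forall x y, f (x * y)%g = (f x * f y)%g) ->
  is_SLrep M -> is_SLrep (M \o f).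
Proof. by move=> fM [d m]; split=> [x|x y] /=; rewrite ?d // fM m. Qed.

Lemma mxtrace_conj (R : comNzRingType) n (G : groupType) (M : G -> 'M[R]_n) x w :
  is_SLrep M -> \tr (M (x ^ w)%g) = \tr (M x).
Proof.
move=> repM; case: (repM) => d m.
by rewrite /conjg !m mxtrace_mulC -mulmxA -m mulgV is_SLrep1 // mulmx1.
Qed.

End LinearRep.

(** * Algebraic closures of prime fields *)

Section ResidueFields.
Local Open Scope ring_scope.

(** An element [y] is a root of a monic [q] over ['F_p]. The remainders of X^(p^i) modulo [q] lie in
    a finite set, so y^(p^i) = y^(p^j) for some i < j, and injectivity of the Frobenius gives the
    period j - i. *)
Lemma exists_Fpbar p : prime p -> exists L : closedFieldType,
  p \in [pchar L] /\ forall y : L, exists2 k, (0 < k)%N & y ^+ (p ^ k) = y.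
Proof.
move=> pp; have [L [f intf]] := countable_algebraic_closure 'F_p.
exists L; have chL : p \in [pchar L] by apply: rmorph_pchar f _ (pchar_Fp pp).
split => // y; have [q mq qy] := intf y.
pose h i : 'rV['F_p]_(size q).-1 := poly_rV ('X^(p ^ i) %% q).
pose m := #|{: 'rV['F_p]_(size q).-1}|.
have [inj|] := pselect (injective (fun i : 'I_m.+1 => h i)).
  by have := leq_card _ inj; rewrite card_ord ltnn.
move=> /existsNP[i /existsNP[j /not_implyP[hij /eqP ij]]].
wlog lij : i j hij ij / (i < j)%N.
  move=> W; have [/W|lji|/val_inj E] := ltngtP i j; first exact.
    by apply: (W j i) => //; rewrite eq_sym.
  by rewrite E eqxx in ij.
have q0 : q != 0 by apply: monic_neq0.
have hE k : (map_poly f ('X^(p ^ k) %% q)).[y] = y ^+ (p ^ k).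
  have /(congr1 (fun r => (map_poly f r).[y])) := divp_eq 'X^(p ^ k) q.
  rewrite rmorphD rmorphM /= hornerD hornerM (rootP qy) mulr0 add0r => <-.
  by rewrite map_polyXn hornerXn.
have E : y ^+ (p ^ i) = y ^+ (p ^ j).
  rewrite -!hE; congr ((map_poly f _).[y]).
  have sz k : (size ('X^(p ^ k) %% q)%R <= (size q).-1)%N.
    by rewrite -ltnS prednK ?size_poly_gt0 // ltn_modp.
  by rewrite -(poly_rV_K (sz i)) -(poly_rV_K (sz j)) -/(h i) hij.
exists (j - i)%N; first by rewrite subn_gt0.
have inj : injective (iter i (pFrobenius_aut chL)).
  elim: (i : nat) => //= k IH a b /fmorph_inj; exact: IH.
have FE k (z : L) : iter k (pFrobenius_aut chL) z = z ^+ (p ^ k).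
  by elim: k => [|k IH]; rewrite ?expr1 //= IH pFrobenius_autE -exprM expnSr.
apply: inj; rewrite !FE -exprM -expnD subnK // ltnW //.
Qed.

(** Multiples of a period are periods, so the product of the periods of the [ys] serves for all of
    them. *)
Lemma common_frobenius_power (L : fieldType) p (ys : seq L) :
  (forall y : L, exists2 k, (0 < k)%N & y ^+ (p ^ k) = y) ->
  exists2 k, (0 < k)%N & {in ys, forall y, y ^+ (p ^ k) = y}.
Proof.
move=> H; have iterE (y : L) k m : y ^+ (p ^ k) = y -> y ^+ (p ^ (k * m)) = y.
  by move=> E; elim: m => [|m IH]; rewrite ?muln0 ?expr1 // mulnS expnD exprM E.
elim: ys => [|y ys [k k0 IH]]; first by exists 1%N.
have [m m0 ym] := H y; exists (k * m)%N; first by rewrite muln_gt0 k0.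
move=> z; rewrite inE => /predU1P[->|zys]; last by apply/iterE/IH.
by rewrite mulnC; apply: iterE.
Qed.

Lemma finitely_many_matrices (L : closedFieldType) n (G : groupType) 
    (M : G -> 'M[L]_n) q :
  (1 < q)%N -> (forall x i j, M x i j ^+ q = M x i j) ->
  exists s : seq G, forall x, exists2 g, g \in s & M x = M g.
Proof.
move=> q1 Mq; have [rs Ers] := closed_field_poly_normal ('X^q - 'X : {poly L}).
have P0 : 'X^q - 'X != 0 :> {poly L}.
  apply/negP => /eqP/(congr1 (fun r : {poly L} => r`_q)).
  rewrite coefB coefXn coefX eqxx coef0 gtn_eqF // subr0 => /eqP.
  by rewrite oner_eq0.
have inrs x i j : M x i j \in rs.
  have : root ('X^q - 'X) (M x i j).
    by rewrite rootE hornerD hornerN hornerXn hornerX Mq subrr.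
  by rewrite Ers rootZ ?root_prod_XsubC // lead_coef_eq0.
(* A matrix is encoded by the positions of its entries in the list [rs] of roots of X^q - X. There
   are finitely many codes, and [pick] selects an element of [G] for each code that occurs. *)
pose idx x : {ffun 'I_n * 'I_n -> 'I_(size rs).+1} :=
  [ffun ij => inord (index (M x ij.1 ij.2) rs)].
pose pick t : G := xget 1%g (fun x => idx x = t).
exists [seq pick t | t <- enum {: {ffun 'I_n * 'I_n -> 'I_(size rs).+1}}] => x.
exists (pick (idx x)); first by apply: map_f; rewrite mem_enum.
have : idx (pick (idx x)) = idx x.
  by rewrite /pick; case: xgetP => [y -> //|/(_ x)].
move=> E; apply/matrixP => i j.
have /(congr1 val) := congr1 (fun t : {ffun _ -> _} => t (i, j)) E.
rewrite !ffunE /= !inordK ?ltnS ?index_size // => Ei.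
by rewrite -(nth_index 0 (inrs x i j)) -Ei nth_index.
Qed.

End ResidueFields.

(** * Derivations of the coordinate ring *)

Section Derivations.
Local Open Scope ring_scope.
Variables (F : closedFieldType) (n : nat) (G : groupType).
Notation rep := (SLrep F n G).

(** A regular function has no canonical expression, so derivations are defined on the syntax first;
    [ev_dexpr_eq] shows that they descend to functions. *)
Inductive expr :=
| Cst of F
| Ent of G & 'I_n & 'I_n
| Add of expr & expr
| Mul of expr & expr.

Fixpoint ev (e : expr) : rep -> F :=
  match e with
  | Cst c => fun=> c
  | Ent x i j => fun rho => rho x i j
  | Add e1 e2 => fun rho => ev e1 rho + ev e2 rho
  | Mul e1 e2 => fun rho => ev e1 rho * ev e2 rho
  end.

Lemma regular_ev (f : rep -> F) : regular f -> exists e, ev e = f.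
Proof.
elim=> [c|x i j|f1 f2 _ [e1 <-] _ [e2 <-]|f1 f2 _ [e1 <-] _ [e2 <-]].
- by exists (Cst c).
- by exists (Ent x i j).
- by exists (Add e1 e2).
- by exists (Mul e1 e2).
Qed.

(* The derivation of the coordinate ring induced by the derivation
   [X |-> E_ab X - X E_ab] of matrices. *)
Fixpoint dexpr (a b : 'I_n) (e : expr) : expr :=
  match e with
  | Cst _ => Cst 0
  | Ent x i j => Add (if i == a then Ent x b j else Cst 0)
                     (if j == b then Mul (Cst (-1)) (Ent x i a) else Cst 0)
  | Add e1 e2 => Add (dexpr a b e1) (dexpr a b e2)
  | Mul e1 e2 => Add (Mul (dexpr a b e1) e2) (Mul e1 (dexpr a b e2))
  end.

Definition elem_mx (a b : 'I_n) (t : F) : 'M[F]_n := 1%:M + t *: delta_mx a b.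

Lemma delta_mxMM (a b : 'I_n) : a != b ->
  delta_mx a b *m delta_mx a b = 0 :> 'M[F]_n.
Proof. by move=> ab; rewrite mul_delta_mx_cond eq_sym (negPf ab) mulr0n. Qed.

Lemma elem_mxM a b t s : a != b ->
  elem_mx a b t *m elem_mx a b s = elem_mx a b (t + s).
Proof.
move=> ab; rewrite /elem_mx mulmxDl mul1mx mulmxDr mulmx1.
rewrite -scalemxAl -scalemxAr delta_mxMM // !scaler0 addr0 scalerDl.
by rewrite -addrA [s *: _ + _]addrC.
Qed.

Lemma elem_mx0 a b : elem_mx a b 0 = 1%:M.
Proof. by rewrite /elem_mx scale0r addr0. Qed.

Lemma det_elem_mx a b t : a != b -> \det (elem_mx a b t) = 1.
Proof.
wlog ab : a b / (b < a)%N => [H ab|_].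
  have [ba|ba] := ltnP b a; first exact: H.
  rewrite -det_tr /elem_mx raddfD /= linearZ /= tr_scalar_mx trmx_delta.
  apply: H; last by rewrite eq_sym.
  by rewrite ltn_neqAle ba andbT -val_eqE in ab *.
rewrite det_trig; last first.
  apply/is_trig_mxP => i j ij; rewrite !mxE -val_eqE (ltn_eqF ij) add0r.
  have [ia|] := eqVneq i a; last by rewrite mulr0.
  have [jb|] := eqVneq j b; last by rewrite andbF mulr0.
  by move: ij; rewrite ia jb ltnNge ltnW.
rewrite big1 // => i _; rewrite !mxE eqxx.
have [ia|] := eqVneq i a; last by rewrite mulr0 addr0.
have [ib|] := eqVneq i b; last by rewrite andbF mulr0 addr0.
by move: ab; rewrite -ia -ib ltnn.
Qed.

Lemma invmx_elem a b t : a != b -> invmx (elem_mx a b t) = elem_mx a b (- t).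
Proof.
move=> ab; have u : elem_mx a b t \in unitmx.
  by rewrite unitmxE det_elem_mx // unitr1.
rewrite -[LHS]mulmx1 -(elem_mx0 a b) -(subrr t) -elem_mxM //.
by rewrite mulmxA mulVmx // mul1mx.
Qed.

Definition conj_elem a b (ab : a != b) t (rho : rep) : rep :=
  SLconj (det_elem_mx t ab) rho.

Lemma mul_delta_mxE (a b i j : 'I_n) (X : 'M[F]_n) :
  (delta_mx a b *m X) i j = (i == a)%:R * X b j.
Proof.
rewrite !mxE (bigD1 b) //= !mxE eqxx andbT big1 ?addr0 // => k kb.
by rewrite mxE (negPf kb) andbF mul0r.
Qed.

Lemma mul_mx_deltaE (a b i j : 'I_n) (X : 'M[F]_n) :
  (X *m delta_mx a b) i j = (j == b)%:R * X i a.
Proof.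
rewrite !mxE (bigD1 a) //= !mxE eqxx mulrC big1 ?addr0 // => k ka.
by rewrite mxE (negPf ka) mulr0.
Qed.

Lemma conj_elemE a b (ab : a != b) t (rho : rep) x i j :
  conj_elem ab t rho x i j = rho x i j
    + t * ((i == a)%:R * rho x b j - (j == b)%:R * rho x i a)
    - t ^+ 2 * ((i == a)%:R * (j == b)%:R * rho x b a).
Proof.
have -> : conj_elem ab t rho x =
    (rho x + t *: (delta_mx a b *m rho x))
    - t *: ((rho x + t *: (delta_mx a b *m rho x)) *m delta_mx a b).
  rewrite /conj_elem /SLconj [LHS]/= invmx_elem // {1}/elem_mx mulmxDl mul1mx.
  by rewrite /elem_mx mulmxDr mulmx1 scaleNr mulmxN -scalemxAl -scalemxAr.
have := mul_delta_mxE a b i j (rho x); have := mul_delta_mxE a b i a (rho x).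
move: (_ *m rho x) => P Pa Pj.
have := mul_mx_deltaE a b i j (rho x + t *: P).
move: (_ *m delta_mx a b) => Q; rewrite !mxE Pa Pj => ->.
ring.
Qed.

(** For a != b this is the function t |-> e(g rho g^-1) with g = 1 + t E_ab, as a polynomial in t.
    Its derivative at 0 is [dexpr a b e], which ties the formal derivation to values on
    representations. *)
Fixpoint curve (a b : 'I_n) (rho : rep) (e : expr) : {poly F} :=
  match e with
  | Cst c => c%:P
  | Ent x i j => (rho x i j)%:P
      + 'X * ((i == a)%:R * rho x b j - (j == b)%:R * rho x i a)%:P
      - 'X^2 * ((i == a)%:R * (j == b)%:R * rho x b a)%:P
  | Add e1 e2 => curve a b rho e1 + curve a b rho e2
  | Mul e1 e2 => curve a b rho e1 * curve a b rho e2
  end.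

Lemma horner_curve a b (ab : a != b) rho e t :
  (curve a b rho e).[t] = ev e (conj_elem ab t rho).
Proof.
elim: e => [c|x i j|e1 IH1 e2 IH2|e1 IH1 e2 IH2].
- by rewrite hornerC.
- by rewrite /ev conj_elemE /= !(hornerD, hornerN, hornerM, hornerC, hornerX, hornerXn).
- by rewrite /= hornerD IH1 IH2.
- by rewrite /= hornerM IH1 IH2.
Qed.

Lemma horner_curve0 a b rho e : (curve a b rho e).[0] = ev e rho.
Proof.
elim: e => [c|x i j|e1 IH1 e2 IH2|e1 IH1 e2 IH2].
- by rewrite hornerC.
- by rewrite /= !(hornerD, hornerN, hornerM, hornerC, hornerX, hornerXn); ring.
- by rewrite /= hornerD IH1 IH2.
- by rewrite /= hornerM IH1 IH2.
Qed.

Lemma deriv_curve a b rho e : (curve a b rho e)^`().[0] = ev (dexpr a b e) rho.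
Proof.
elim: e => [c|x i j|e1 IH1 e2 IH2|e1 IH1 e2 IH2].
- by rewrite /= derivC hornerC.
- rewrite /= !derivE 
    !(hornerD, hornerN, hornerM, hornerC, hornerX, hornerXn, horner0, hornerMn) /=.
  by case: eqP => _; case: eqP => _ /=; ring.
- by rewrite /= derivD hornerD IH1 IH2.
- by rewrite /= derivM hornerD !hornerM IH1 IH2 !horner_curve0.
Qed.

Lemma poly_fun_inj (p q : {poly F}) : (forall t, p.[t] = q.[t]) -> p = q.
Proof.
move=> pq; apply/eqP; rewrite -subr_eq0; apply/negPn/negP.
move=> /closed_nonrootP[t]; rewrite rootE hornerD hornerN pq subrr.
by rewrite eqxx.
Qed.

Definition comm_expr a b e : expr :=
  Add (dexpr a b (dexpr b a e)) (Mul (Cst (-1)) (dexpr b a (dexpr a b e))).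

(** This is the commutator of E_ab and E_ba, with the sign reversed because the derivations act on
    coordinate functions. Both sides are derivations, so the check reduces to entries. *)
Lemma ev_comm_expr a b e rho : a != b ->
  ev (comm_expr a b e) rho = ev (dexpr b b e) rho - ev (dexpr a a e) rho.
Proof.
move=> ab; elim: e => [c|x i j|e1 IH1 e2 IH2|e1 IH1 e2 IH2].
- by rewrite /=; ring.
- have ba : b != a by rewrite eq_sym.
  have [ia|ia] := eqVneq i a; have [ib|ib] := eqVneq i b;
  have [ja|ja] := eqVneq j a; have [jb|jb] := eqVneq j b;
  try (by case/eqP: ab; congruence);
  do ?[rewrite /= ?ia ?ib ?ja ?jb ?eqxx ?(negPf ab) ?(negPf ba) ?(negPf ia)
    ?(negPf ib) ?(negPf ja) ?(negPf jb) /=]; ring.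
- transitivity (ev (comm_expr a b e1) rho + ev (comm_expr a b e2) rho).
    by rewrite /=; ring.
  by rewrite IH1 IH2 /=; ring.
- transitivity (ev (comm_expr a b e1) rho * ev e2 rho
    + ev e1 rho * ev (comm_expr a b e2) rho); first by rewrite /=; ring.
  by rewrite IH1 IH2 /=; ring.
Qed.

Lemma ev_dexpr_Ent a b x i j rho : ev (dexpr a b (Ent x i j)) rho =
  (i == a)%:R * rho x b j - (j == b)%:R * rho x i a.
Proof. by rewrite /=; case: eqP => _; case: eqP => _ /=; ring. Qed.

Lemma sum_delta (f : 'I_n -> F) i : \sum_b (i == b)%:R * f b = f i.
Proof.
rewrite (bigD1 i) //= eqxx mul1r big1 ?addr0 // => b.
by rewrite eq_sym => /negPf ->; rewrite mul0r.
Qed.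

(** The E_bb add up to the identity, which commutes with every matrix. *)
Lemma sum_dexpr_diag e rho : \sum_b ev (dexpr b b e) rho = 0.
Proof.
elim: e => [c|x i j|e1 IH1 e2 IH2|e1 IH1 e2 IH2].
- by rewrite big1.
- under eq_bigr do rewrite ev_dexpr_Ent.
  by rewrite sumrB !sum_delta subrr.
- by rewrite big_split /= IH1 IH2 addr0.
- by rewrite big_split /= -mulr_suml -mulr_sumr IH1 IH2 mul0r mulr0 addr0.
Qed.

Hypothesis charF : [pchar F] =i pred0.

Lemma ord_dim_neq0 (a : 'I_n) : n%:R != 0 :> F.
Proof. by rewrite ((pcharf0P F).1 charF) -lt0n; apply: leq_trans (ltn_ord a). Qed.

(** The matrices 1 + t E_aa leave SL_n, so D_aa has no curve of its own. The commutators D_aa -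
    D_bb, summed over b != a, give n D_aa because all the D_bb together add up to zero. *)
Lemma ev_dexpr_diag a e rho :
  n%:R * ev (dexpr a a e) rho = \sum_(b | b != a) ev (comm_expr b a e) rho.
Proof.
have nE : n%:R = n.-1%:R + 1 :> F.
  by rewrite natr1 prednK //; apply: leq_trans (ltn_ord a).
under eq_bigr do rewrite ev_comm_expr //.
have := sum_dexpr_diag e rho; rewrite (bigD1 a) //= => /eqP.
rewrite addr_eq0 => /eqP E; rewrite sumrB sumr_const (cardC1 a) card_ord.
by rewrite nE mulrDl mul1r mulr_natl {2}E.
Qed.

(* By [ev_dexpr_diag] and since each [conj_elem] curve lies in [SL_n], the
   derivations [D_ab], including [D_aa], are well defined on functions. *)
Lemma ev_dexpr_eq a b e1 e2 : ev e1 = ev e2 ->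
  ev (dexpr a b e1) = ev (dexpr a b e2).
Proof.
have off a' b' f1 f2 : a' != b' -> ev f1 = ev f2 ->
    ev (dexpr a' b' f1) = ev (dexpr a' b' f2).
  move=> ab E; apply/funext => rho; rewrite -!deriv_curve.
  congr (_^`().[0]); apply: poly_fun_inj => t.
  by rewrite !horner_curve E.
have [<-|ab] := eqVneq a b; last exact: off.
move=> E; apply/funext => rho; apply: (mulfI (ord_dim_neq0 a)).
rewrite !ev_dexpr_diag; apply: eq_bigr => c ca /=.
have ac : a != c by rewrite eq_sym.
by rewrite (off _ _ _ _ ca (off _ _ _ _ ac E)) (off _ _ _ _ ac (off _ _ _ _ ca E)).
Qed.

(** An invariant function is constant along every conjugation curve, which settles the off-diagonal
    derivations; the diagonal ones follow through their commutators. *)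
Lemma ev_dexpr_invariant a b e : SLinvariant (ev e) -> ev (dexpr a b e) = fun=> 0.
Proof.
move=> inv; have off a' b' : a' != b' -> ev (dexpr a' b' e) = fun=> 0.
  move=> ab; apply/funext => rho; rewrite -deriv_curve.
  have -> : curve a' b' rho e = (ev e rho)%:P.
    by apply: poly_fun_inj => t; rewrite (horner_curve ab) hornerC inv.
  by rewrite derivC hornerC.
have [<-|ab] := eqVneq a b; last exact: off.
apply/funext => rho; apply: (mulfI (ord_dim_neq0 a)).
rewrite ev_dexpr_diag mulr0 big1 // => c ca /=.
have ac : a != c by rewrite eq_sym.
have off0 a' b' f : ev f = (fun=> 0) -> ev (dexpr a' b' f) = fun=> 0.
  by move=> f0; rewrite (ev_dexpr_eq _ _ (f0 : ev f = ev (Cst 0))).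
by rewrite (off0 _ _ _ (off _ _ ca)) (off0 _ _ _ (off _ _ ac)) mulr0 addr0.
Qed.

(** The expression of [f] is obtained by choice, harmlessly by [ev_dexpr_eq]; functions without an
    expression get the default value zero. *)
Definition deriv_fun (a b : 'I_n) (f : rep -> F) : rep -> F :=
  if pselect (exists e, ev e = f) is left ex then ev (dexpr a b (projT1 (cid ex)))
  else fun=> 0.

Lemma deriv_fun_ev a b e : deriv_fun a b (ev e) = ev (dexpr a b e).
Proof.
rewrite /deriv_fun; case: pselect => [ex|[]]; last by exists e.
by apply: ev_dexpr_eq; case: cid.
Qed.

Lemma regularV e : regular (ev e).
Proof.
elim: e => [c|x i j|e1 IH1 e2 IH2|e1 IH1 e2 IH2].
- exact: regular_cst.
- exact: regular_entry.
- exact: regularD.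
- exact: regularM.
Qed.

Lemma regular_deriv_fun a b f : regular f -> regular (deriv_fun a b f).
Proof. by move=> /regular_ev[e <-]; rewrite deriv_fun_ev; apply: regularV. Qed.

Lemma deriv_fun_add a b f g : regular f -> regular g ->
  deriv_fun a b (f \+ g) = deriv_fun a b f \+ deriv_fun a b g.
Proof.
move=> /regular_ev[e <-] /regular_ev[e' <-].
by rewrite (deriv_fun_ev _ _ (Add e e')) !deriv_fun_ev.
Qed.

Lemma deriv_fun_mul a b f g : regular f -> regular g ->
  deriv_fun a b (f \* g) = (deriv_fun a b f \* g) \+ (f \* deriv_fun a b g).
Proof.
move=> /regular_ev[e <-] /regular_ev[e' <-].
by rewrite (deriv_fun_ev _ _ (Mul e e')) !deriv_fun_ev.
Qed.

Lemma deriv_fun_invariant a b f : regular f -> SLinvariant f ->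
  deriv_fun a b f = fun=> 0.
Proof. by move=> /regular_ev[e <-] inv; rewrite deriv_fun_ev ev_dexpr_invariant. Qed.

Lemma deriv_fun_entry a b x i j : deriv_fun a b (fun rho => rho x i j) =
  fun rho => (i == a)%:R * rho x b j - (j == b)%:R * rho x i a.
Proof.
by rewrite (deriv_fun_ev _ _ (Ent x i j)); apply/funext => rho; rewrite ev_dexpr_Ent.
Qed.

End Derivations.

(** * The Casimir matrix *)

Section CasimirMatrix.
Local Open Scope ring_scope.
Variables (n d : nat).
Notation mindex := ({ffun 'I_d -> 'I_n} * {ffun 'I_d -> 'I_n})%type.
Notation N := #|{: mindex}|.

Definition upd (I : {ffun 'I_d -> 'I_n}) k b : {ffun 'I_d -> 'I_n} :=
  [ffun l => if l == k then b else I l].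

(** An index [u] stands for a monomial of degree d with row indices [u.1] and column indices [u.2].
    By the Leibniz rule D_ab acts on it as a sum over positions of row replacements of a by b, minus
    column replacements of b by a. *)
Definition row_step (a b : 'I_n) (k : 'I_d) (u v : mindex) : bool :=
  (u.1 k == a) && (v == (upd u.1 k b, u.2)).

Definition col_step (a b : 'I_n) (k : 'I_d) (u v : mindex) : bool :=
  (u.2 k == b) && (v == (u.1, upd u.2 k a)).

(** Replacing a by b at position k is undone by replacing b by a; hence transposing a matrix of
    moves exchanges a and b. *)
Lemma upd_swap (I J : {ffun 'I_d -> 'I_n}) k a b :
  (I k == a) && (J == upd I k b) = (J k == b) && (I == upd J k a).
Proof.
wlog suff H : I J a b / (I k == a) && (J == upd I k b) ->
    (J k == b) && (I == upd J k a).
  by apply/idP/idP; apply: H.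
move=> /andP[/eqP Ia /eqP ->]; rewrite ffunE eqxx eqxx /=.
apply/eqP/ffunP => l; rewrite !ffunE; case: eqP => [->|] //.
Qed.

Lemma row_step_sym a b k u v : row_step a b k u v = row_step b a k v u.
Proof.
case: u v => [I J] [I' J']; rewrite /row_step /= !xpair_eqE !andbA upd_swap.
by rewrite [J' == J]eq_sym.
Qed.

Lemma col_step_sym a b k u v : col_step a b k u v = col_step b a k v u.
Proof.
case: u v => [I J] [I' J']; rewrite /col_step /= !xpair_eqE.
rewrite andbCA upd_swap [I' == I]eq_sym.
by rewrite andbCA.
Qed.

Section Ring.
Variable R : comNzRingType.

Definition row_move_mx a b : 'M[R]_N :=
  \matrix_(p, q) \sum_k (row_step a b k (enum_val p) (enum_val q))%:R.

Definition col_move_mx a b : 'M[R]_N :=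
  \matrix_(p, q) \sum_k (col_step a b k (enum_val p) (enum_val q))%:R.

(** This is the leading part of the Casimir operator on monomials of degree d. Products of a row
    move with a column move are left out, as they lower the degree over the traces. *)
Definition casimir_mx : 'M[R]_N := \sum_a \sum_b
  (row_move_mx b a *m row_move_mx a b + col_move_mx b a *m col_move_mx a b).

Lemma tr_row_move_mx a b : (row_move_mx a b)^T = row_move_mx b a.
Proof.
by apply/matrixP => p q; rewrite !mxE; apply: eq_bigr => k _; rewrite row_step_sym.
Qed.

Lemma tr_col_move_mx a b : (col_move_mx a b)^T = col_move_mx b a.
Proof.
by apply/matrixP => p q; rewrite !mxE; apply: eq_bigr => k _; rewrite col_step_sym.
Qed.

Lemma sum_row_move_mx a b p (g : mindex -> R) :
  \sum_q row_move_mx a b p q * g (enum_val q) =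
  \sum_k ((enum_val p).1 k == a)%:R * g (upd (enum_val p).1 k b, (enum_val p).2).
Proof.
under eq_bigr do rewrite mxE mulr_suml.
rewrite exchange_big; apply: eq_bigr => k _ /=.
set v := (upd _ _ _, _).
rewrite (bigD1 (enum_rank v)) //= enum_rankK /row_step eqxx andbT.
rewrite big1 ?addr0 // => q qv.
have -> : (enum_val q == v) = false.
  by apply: contra_neqF qv => /eqP <-; rewrite enum_valK.
by rewrite andbF mul0r.
Qed.

Lemma sum_col_move_mx a b p (g : mindex -> R) :
  \sum_q col_move_mx a b p q * g (enum_val q) =
  \sum_k ((enum_val p).2 k == b)%:R * g ((enum_val p).1, upd (enum_val p).2 k a).
Proof.
under eq_bigr do rewrite mxE mulr_suml.
rewrite exchange_big; apply: eq_bigr => k _ /=.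
set v := (_, upd _ _ _).
rewrite (bigD1 (enum_rank v)) //= enum_rankK /col_step eqxx andbT.
rewrite big1 ?addr0 // => q qv.
have -> : (enum_val q == v) = false.
  by apply: contra_neqF qv => /eqP <-; rewrite enum_valK.
by rewrite andbF mul0r.
Qed.

End Ring.

Lemma map_casimir_mx (R : comNzRingType) :
  map_mx intr (casimir_mx int) = casimir_mx R.
Proof.
have Er a b : map_mx intr (row_move_mx int a b) = row_move_mx R a b.
  by apply/matrixP => p q; rewrite !mxE rmorph_sum; apply: eq_bigr => k _;
    rewrite /= rmorph_nat.
have Ec a b : map_mx intr (col_move_mx int a b) = col_move_mx R a b.
  by apply/matrixP => p q; rewrite !mxE rmorph_sum; apply: eq_bigr => k _;
    rewrite /= rmorph_nat.
rewrite /casimir_mx raddf_sum; apply: eq_bigr => a _ /=.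
rewrite raddf_sum; apply: eq_bigr => b _ /=.
by rewrite map_mxD !map_mxM !Er !Ec.
Qed.

Lemma mulmx_tr_ge0 m (v : 'rV[int]_m) : 0 <= (v *m v^T) 0 0.
Proof.
by rewrite mxE; apply: sumr_ge0 => i _; rewrite mxE -expr2 sqr_ge0.
Qed.

Lemma mulmx_tr_eq0 m (v : 'rV[int]_m) : (v *m v^T) 0 0 = 0 -> v = 0.
Proof.
rewrite mxE => /eqP; rewrite psumr_eq0 => [/allP v0|i _]; last first.
  by rewrite mxE -expr2 sqr_ge0.
apply/rowP => i; have := v0 i (mem_index_enum _).
by rewrite !mxE -expr2 sqrf_eq0 => /eqP.
Qed.

(* [casimir_mx] is a sum of matrices [A^T A], and the summands for [a = b] have
   no common kernel when [d > 0]. *)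
Lemma casimir_mx_inj (w : 'rV[int]_N) : (0 < d)%N ->
  w *m casimir_mx int = 0 -> w = 0.
Proof.
move=> d0 w0; have /eqP : (w *m casimir_mx int *m w^T) 0 0 = 0.
  by rewrite w0 mul0mx mxE.
have -> : (w *m casimir_mx int *m w^T) 0 0 = \sum_a \sum_b
    (((w *m row_move_mx int b a) *m (w *m row_move_mx int b a)^T) 0 0 +
     ((w *m col_move_mx int b a) *m (w *m col_move_mx int b a)^T) 0 0).
  rewrite /casimir_mx mulmx_sumr mulmx_suml summxE; apply: eq_bigr => a _.
  rewrite mulmx_sumr mulmx_suml summxE; apply: eq_bigr => b _.
  rewrite mulmxDr mulmxDl mxE !trmx_mul tr_row_move_mx tr_col_move_mx.
  by rewrite !mulmxA.
rewrite psumr_eq0 => [|a _]; last first.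
  by apply: sumr_ge0 => b _; rewrite addr_ge0 ?mulmx_tr_ge0.
move=> /allP w1; apply/rowP => p; rewrite [RHS]mxE.
(* Coordinate p of [w] is tested with the row index of p at the first position: the matrix of row
   moves from a to a is diagonal, and its entry at p counts the occurrences of a, here at least
   one. *)
pose a := (enum_val p).1 (Ordinal d0).
have := w1 a (mem_index_enum _); rewrite psumr_eq0 => [|b _]; last first.
  by rewrite addr_ge0 ?mulmx_tr_ge0.
move=> /allP/(_ a (mem_index_enum _)).
rewrite paddr_eq0 ?mulmx_tr_ge0 // => /andP[/eqP/mulmx_tr_eq0 wa _].
have : (w *m row_move_mx int a a) 0 p = 0 by rewrite wa mxE.
rewrite mxE (bigD1 p) //= big1 ?addr0 => [|q qp]; last first.
  rewrite mxE big1 ?mulr0 // => k _; rewrite row_step_sym /row_step.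
  have [|//] := eqVneq (_ k) a; move=> E.
  have -> : upd (enum_val p).1 k a = (enum_val p).1.
    by apply/ffunP => l; rewrite ffunE; case: eqP => // ->.
  rewrite -surjective_pairing /=.
  by rewrite (inj_eq enum_val_inj) (negPf qp).
move/eqP; rewrite mulf_eq0 => /orP[/eqP //|].
rewrite mxE psumr_eq0 // => /allP/(_ (Ordinal d0) (mem_index_enum _)).
rewrite /row_step eqxx /=.
have -> : upd (enum_val p).1 (Ordinal d0) a = (enum_val p).1.
  by apply/ffunP => l; rewrite ffunE; case: eqP => // ->.
by rewrite -surjective_pairing eqxx.
Qed.

End CasimirMatrix.

Section Annihilator.
Local Open Scope ring_scope.

Lemma intr_pchar0_eq0 (F : fieldType) (charF : [pchar F] =i pred0) (z : int) :
  (z%:~R == 0 :> F) = (z == 0).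
Proof.
have c0 := (pcharf0P F).1 charF.
case: z => m; first exact: c0.
by rewrite NegzE rmorphN /= oppr_eq0 -pmulrn c0.
Qed.

(** The characteristic polynomial serves: its constant term is, up to sign, the determinant of [A],
    a nonzero integer, which stays nonzero in characteristic zero. *)
Lemma annihilating_poly (F : fieldType) (charF : [pchar F] =i pred0) N
    (A : 'M[int]_N) : (forall w : 'rV_N, w *m A = 0 -> w = 0) ->
  exists2 p : {poly F}, p`_0 != 0 &
    \sum_(j < size p) p`_j *: (map_mx intr A : 'M[F]_N) ^+ j = 0.
Proof.
case: N A => [|N] A injA.
  by exists 1; rewrite ?coefC ?oner_eq0 //; apply: flatmx0.
pose B : 'M[F]_N.+1 := map_mx intr A.
exists (char_poly B).
  rewrite char_poly_det mulf_neq0 ?expf_neq0 ?oppr_eq0 ?oner_eq0 //.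
  rewrite det_map_mx; apply/negP.
  have : \det A != 0.
    by apply/negP => /det0P[v v0 /injA v1]; rewrite v1 eqxx in v0.
  by rewrite -(intr_pchar0_eq0 charF) => /negP.
have := Cayley_Hamilton B; rewrite /horner_mx /horner_morph /= => H.
rewrite -[RHS]H horner_coef size_map_poly.
by apply: eq_bigr => i _; rewrite coef_map /= -mulmxE mul_scalar_mx.
Qed.

End Annihilator.

(** * Invariants are generated by traces *)

Section Traces.
Local Open Scope ring_scope.
Variables (F : closedFieldType) (n : nat) (G : groupType).
Hypothesis charF : [pchar F] =i pred0.
Variable S : set G.
Hypothesis semiS : is_semigroup S.
Notation rep := (SLrep F n G).
Notation mindex d := ({ffun 'I_d -> 'I_n} * {ffun 'I_d -> 'I_n})%type.
Notation D := (@deriv_fun F n G).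

Lemma regular_sum I (r : seq I) (P : pred I) (f : I -> rep -> F) :
  (forall i, regular (f i)) -> regular (fun rho => \sum_(i <- r | P i) f i rho).
Proof.
move=> rf; elim: r => [|i r IH].
  by under eq_fun do rewrite big_nil; apply: regular_cst.
under eq_fun do rewrite big_cons; case: (P i) => //.
exact: regularD.
Qed.

Lemma regular_prod I (r : seq I) (P : pred I) (f : I -> rep -> F) :
  (forall i, regular (f i)) -> regular (fun rho => \prod_(i <- r | P i) f i rho).
Proof.
move=> rf; elim: r => [|i r IH].
  by under eq_fun do rewrite big_nil; apply: regular_cst.
under eq_fun do rewrite big_cons; case: (P i) => //.
exact: regularM.
Qed.

Lemma deriv_fun_cst a b c : D a b (fun=> c) = fun=> 0.
Proof. by rewrite (deriv_fun_ev charF _ _ (Cst n G c)). Qed.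

Lemma deriv_fun_lin a b I (r : seq I) (c : I -> F) (f : I -> rep -> F) :
  (forall i, regular (f i)) ->
  D a b (fun rho => \sum_(i <- r) c i * f i rho) =
  fun rho => \sum_(i <- r) c i * D a b (f i) rho.
Proof.
move=> rf; have rcf i : regular ((fun=> c i) \* f i).
  exact: (regularM (regular_cst _ _ _) (rf i)).
elim: r => [|i r IH].
  under eq_fun do rewrite big_nil; rewrite deriv_fun_cst.
  by apply/funext => rho; rewrite big_nil.
under eq_fun do rewrite big_cons.
rewrite (deriv_fun_add charF a b (rcf i) (regular_sum r _ rcf)) IH.
rewrite deriv_fun_mul //; last exact: regular_cst.
by apply/funext => rho; rewrite big_cons deriv_fun_cst /= mul0r add0r.
Qed.

Lemma deriv_fun_prod a b (I : eqType) (r : seq I) (f : I -> rep -> F) :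
  uniq r -> (forall i, regular (f i)) ->
  D a b (fun rho => \prod_(i <- r) f i rho) =
  fun rho => \sum_(i <- r) D a b (f i) rho * \prod_(j <- r | j != i) f j rho.
Proof.
move=> + rf; elim: r => [_|i r IH /= /andP[ir ur]].
  under eq_fun do rewrite big_nil; rewrite deriv_fun_cst.
  by apply/funext => rho; rewrite big_nil.
under eq_fun do rewrite big_cons.
rewrite (deriv_fun_mul charF a b (rf i) (regular_prod r _ rf)) (IH ur).
apply/funext => rho; rewrite big_cons big_cons eqxx /=; congr (_ * _ + _).
  rewrite [LHS]big_seq_cond [RHS]big_seq_cond; apply: eq_bigl => j.
  by case jr: (j \in r) => //=; apply/esym; apply: contraNneq ir => <-.
rewrite mulr_sumr [LHS]big_seq [RHS]big_seq; apply: eq_bigr => j jr.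
rewrite big_cons; have -> : i != j by apply: contraNneq ir => ->.
by rewrite mulrCA.
Qed.

Definition mon d (x : 'I_d -> G) (u : mindex d) : rep -> F :=
  fun rho => \prod_k rho (x k) (u.1 k) (u.2 k).

Lemma regular_mon d (x : 'I_d -> G) u : regular (mon x u).
Proof. by apply: regular_prod => k; apply: regular_entry. Qed.

Definition deriv_mx d a b : 'M[F]_#|{: mindex d}| :=
  row_move_mx d F a b - col_move_mx d F a b.

Lemma deriv_fun_mon d (x : 'I_d -> G) a b p :
  D a b (mon x (enum_val p)) =
  fun rho => \sum_q deriv_mx d a b p q * mon x (enum_val q) rho.
Proof.
rewrite /mon deriv_fun_prod; [|exact: index_enum_uniq|move=> k; exact: regular_entry].
apply/funext => rho; rewrite /deriv_mx.
have -> : \sum_q (row_move_mx d F a b - col_move_mx d F a b) p q *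
      mon x (enum_val q) rho
    = \sum_q row_move_mx d F a b p q * mon x (enum_val q) rho
      - \sum_q col_move_mx d F a b p q * mon x (enum_val q) rho.
  by rewrite -sumrB; apply: eq_bigr => q _; rewrite !mxE mulrBl.
rewrite (sum_row_move_mx a b p (mon x ^~ rho)) (sum_col_move_mx a b p (mon x ^~ rho)).
rewrite -sumrB; apply: eq_bigr => k _; rewrite deriv_fun_entry // mulrBl.
(* Monomials whose indices agree with those of p off position k differ only in their factor at k. *)
have others (v : mindex d) : (forall l, l != k -> v.1 l = (enum_val p).1 l /\
    v.2 l = (enum_val p).2 l) -> mon x v rho =
    rho (x k) (v.1 k) (v.2 k) * \prod_(l | l != k)
      rho (x l) ((enum_val p).1 l) ((enum_val p).2 l).
  move=> vE; rewrite /mon (bigD1 k) //=; congr (_ * _); apply: eq_bigr => l lk.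
  by have [-> ->] := vE l lk.
rewrite !others => [|l /negPf lk|l /negPf lk]; rewrite /= ?ffunE ?eqxx ?lk //.
by rewrite !mulrA.
Qed.

Inductive trpoly : (rep -> F) -> Prop :=
| trpoly_cst c : trpoly (fun=> c)
| trpoly_tr s : S s -> trpoly (fun rho => \tr (rho s))
| trpoly_add f g : trpoly f -> trpoly g -> trpoly (fun rho => f rho + g rho)
| trpoly_mul f g : trpoly f -> trpoly g -> trpoly (fun rho => f rho * g rho).

Lemma trpoly_charfun t : trpoly t -> regular t /\ SLinvariant t.
Proof.
elim=> [c|s _|f g _ [rf vf] _ [rg vg]|f g _ [rf vf] _ [rg vg]].
- by split=> //; apply: regular_cst.
- exact/asboolP/(charfun_traceP F n s).
- by split=> [|h h1 rho]; [apply: regularD | rewrite vf vg].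
- by split=> [|h h1 rho]; [apply: regularM | rewrite vf vg].
Qed.

(** An entry at any element of [S] has degree one, even if that element is a product, and traces
    have degree zero; this is why contracting two indices lowers the degree. *)
Inductive deg_le (d : nat) : (rep -> F) -> Prop :=
| deg_le_mon e (x : 'I_e -> G) u t : (e <= d)%N -> (forall k, S (x k)) ->
    trpoly t -> deg_le d (fun rho => t rho * mon x u rho)
| deg_le_add f g : deg_le d f -> deg_le d g -> deg_le d (fun rho => f rho + g rho).

Lemma deg_le_regular d f : deg_le d f -> regular f.
Proof.
elim=> [e x u t _ _ /trpoly_charfun[rt _]|{}f g _ rf _ rg].
  by apply: regularM rt _; apply: regular_mon.
exact: regularD.
Qed.

Lemma deg_le_trans d e f : (d <= e)%N -> deg_le d f -> deg_le e f.
Proof.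
move=> de; elim=> [m x u t md xS tt|{}f g _ rf _ rg]; last exact: deg_le_add.
by apply: deg_le_mon => //; apply: leq_trans de.
Qed.

Lemma mon0 (x : 'I_0 -> G) u rho : mon x u rho = 1.
Proof. by rewrite /mon big_ord0. Qed.

Lemma deg_le_trpoly d t : trpoly t -> deg_le d t.
Proof.
move=> tt; pose x (k : 'I_0) : G := 1%g.
(* Functions on the empty set are built by absurdity, as no element of ['I_n] is at hand when n =
   0. *)
pose u : mindex 0 := ([ffun k : 'I_0 => False_rect _ (notF (ltn_ord k))],
  [ffun k : 'I_0 => False_rect _ (notF (ltn_ord k))]).
have -> : t = fun rho => t rho * mon x u rho.
  by apply/funext => rho; rewrite mon0 mulr1.
by apply: deg_le_mon => // -[].
Qed.

Lemma deg_le0_trpoly f : deg_le 0 f -> trpoly f.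
Proof.
elim=> [e x u t + _ tt|{}f g _ tf _ tg]; last exact: trpoly_add.
rewrite leqn0 => /eqP e0; case: _ / (esym e0) x u => x u.
by under eq_fun do rewrite mon0 mulr1.
Qed.

Lemma deg_le_sum d I (r : seq I) (P : pred I) (f : I -> rep -> F) :
  (forall i, P i -> deg_le d (f i)) ->
  deg_le d (fun rho => \sum_(i <- r | P i) f i rho).
Proof.
move=> rf; elim: r => [|i r IH].
  under eq_fun do rewrite big_nil; apply: deg_le_trpoly; exact: trpoly_cst.
under eq_fun do rewrite big_cons; case Pi: (P i) => //.
by apply: deg_le_add => //; apply: rf.
Qed.

Lemma deg_le_trmul d t f : trpoly t -> deg_le d f ->
  deg_le d (fun rho => t rho * f rho).
Proof.
move=> tt; elim=> [e x u s ed xS ts|{}f g _ rf _ rg].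
  under eq_fun do rewrite mulrA.
  by apply: deg_le_mon ed xS _; apply: trpoly_mul.
by under eq_fun do rewrite mulrDr; apply: deg_le_add.
Qed.

Lemma mon_cat d e (x : 'I_d -> G) (y : 'I_e -> G) u v :
  exists w, mon x u \* mon y v =
    mon (fun k => match fintype.split k with inl l => x l | inr l => y l end) w.
Proof.
pose cat (I : {ffun 'I_d -> 'I_n}) (J : {ffun 'I_e -> 'I_n}) :=
  [ffun k => match fintype.split k with inl l => I l | inr l => J l end].
exists (cat u.1 v.1, cat u.2 v.2); apply/funext => rho.
rewrite /mon big_split_ord /=; congr (_ * _); apply: eq_bigr => k _;
  by rewrite !ffunE -/(unsplit (inl k)) -/(unsplit (inr k)) unsplitK.
Qed.

Lemma deg_le_mul d e f g : deg_le d f -> deg_le e g ->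
  deg_le (d + e) (fun rho => f rho * g rho).
Proof.
move=> rf rg; elim: rf => [m x u t md xS tt|{}f f' _ IH _ IH']; last first.
  by under eq_fun do rewrite mulrDl; apply: deg_le_add.
elim: rg => [m' y v s me yS ts|{}g g' _ IH _ IH']; last first.
  by under eq_fun do rewrite mulrDr; apply: deg_le_add.
under eq_fun do rewrite mulrACA.
have [w E] := mon_cat x y u v; have {}E rho := congr1 (fun h => h rho) E.
under eq_fun do rewrite [X in _ * X]E.
apply: (@deg_le_mon _ _ _ _ (fun rho => t rho * s rho)); first exact: leq_add.
  by move=> k; case: fintype.split.
exact: trpoly_mul.
Qed.

Lemma deg_le_entry s i j : S s -> deg_le 1 (fun rho => rho s i j).
Proof.
move=> Ss; have -> : (fun rho : rep => rho s i j) =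
    fun rho => 1 * mon (fun k : 'I_1 => s) ([ffun=> i], [ffun=> j]) rho.
  by apply/funext => rho; rewrite /mon big_ord1 mul1r /= !ffunE.
by apply: (@deg_le_mon _ _ _ _ (fun=> 1)) => //; apply: trpoly_cst.
Qed.

Lemma deg_le_prod_entry (I : finType) (P : pred I) (x : I -> G) (u v : I -> 'I_n) :
  (forall k, S (x k)) ->
  deg_le #|P| (fun rho => \prod_(k | P k) rho (x k) (u k) (v k)).
Proof.
move=> xS; rewrite cardE.
have -> : (fun rho : rep => \prod_(k | P k) rho (x k) (u k) (v k)) =
    fun rho => \prod_(k <- enum P) rho (x k) (u k) (v k).
  by apply/funext => rho; rewrite big_enum.
elim: (enum P) => [|k r IH] /=.
  by under eq_fun do rewrite big_nil; apply: deg_le_trpoly; apply: trpoly_cst.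
under eq_fun do rewrite big_cons.
by rewrite -add1n; apply: deg_le_mul => //; apply: deg_le_entry.
Qed.

(* The products of a [row_move_mx] and a [col_move_mx] in the Casimir operator
   contract two indices: they produce a trace, or merge two factors into the
   entry of a product. *)
Lemma deg_le_contract d (x : 'I_d.+1 -> G) (I J : {ffun 'I_d.+1 -> 'I_n}) k l :
  (forall k, S (x k)) ->
  deg_le d (fun rho => \sum_a mon x (upd I k a, upd J l a) rho).
Proof.
move=> xS; have [<-|kl] := eqVneq k l.
  have -> : (fun rho => \sum_a mon x (upd I k a, upd J k a) rho) =
      fun rho => \tr (rho (x k)) * \prod_(m | m != k) rho (x m) (I m) (J m).
    apply/funext => rho; rewrite /mxtrace mulr_suml; apply: eq_bigr => a _.
    rewrite /mon (bigD1 k) //= !ffunE eqxx; congr (_ * _).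
    by apply: eq_bigr => m /negPf mk; rewrite !ffunE mk.
  apply: deg_le_trmul; first exact: trpoly_tr.
  have := deg_le_prod_entry (fun m => m != k) I J xS.
  by rewrite (cardC1 k) card_ord.
have -> : (fun rho => \sum_a mon x (upd I k a, upd J l a) rho) =
    fun rho => rho (x l * x k)%g (I l) (J k) *
      \prod_(m | (m != k) && (m != l)) rho (x m) (I m) (J m).
  apply/funext => rho; rewrite SLrepM mxE mulr_suml; apply: eq_bigr => a _.
  rewrite /mon (bigD1 k) //= (bigD1 l) 1?eq_sym //= !ffunE !eqxx (negPf kl).
  rewrite eq_sym (negPf kl) mulrA [X in X * _ = _]mulrC; congr (_ * _).
  by apply: eq_bigr => m /andP[/negPf mk /negPf ml]; rewrite !ffunE mk ml.
have := deg_le_prod_entry (fun m => (m != k) && (m != l)) I J xS.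
have -> : #|fun m : 'I_d.+1 => (m != k) && (m != l)| = d.-1.
  rewrite (@eq_card _ _ [predC pred2 k l]) => [|m].
    have := cardC (pred2 k l); rewrite card2 kl card_ord addSn add1n => -[E].
    by rewrite -[RHS]/(d.-1) -[in RHS]E.
  by rewrite !inE negb_or.
(* Two distinct positions force d > 0, so one merged entry and d - 1 untouched ones make degree
   d. *)
have d0 : (0 < d)%N.
  rewrite lt0n; apply: contraNneq kl => d0; apply/eqP/val_inj => /=.
  by move: (ltn_ord k) (ltn_ord l) d0; lia.
move=> R1; apply: (@deg_le_trans (1 + d.-1)); first by rewrite add1n prednK.
by apply: deg_le_mul R1; apply: deg_le_entry; apply: semiS.
Qed.

Definition casimir (f : rep -> F) : rep -> F :=
  fun rho => \sum_a \sum_b D a b (D b a f) rho.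

Lemma regular_casimir f : regular f -> regular (casimir f).
Proof.
by move=> rf; do 2!apply: regular_sum => ?; do 2!apply: (regular_deriv_fun charF).
Qed.

Lemma casimir_lin I (r : seq I) (c : I -> F) (f : I -> rep -> F) :
  (forall i, regular (f i)) ->
  casimir (fun rho => \sum_(i <- r) c i * f i rho) =
  fun rho => \sum_(i <- r) c i * casimir (f i) rho.
Proof.
move=> rf; apply/funext => rho; rewrite /casimir.
have rD a b i : regular (D a b (f i)) by apply: regular_deriv_fun.
under eq_bigr => a _ do under eq_bigr => b _ do
  rewrite (@deriv_fun_lin _ _ I r c f rf) (@deriv_fun_lin _ _ I r c _ (rD b a)).
under [RHS]eq_bigr do rewrite mulr_sumr.
rewrite [RHS]exchange_big; apply: eq_bigr => a _ /=.
under [RHS]eq_bigr do rewrite mulr_sumr.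
by rewrite [RHS]exchange_big; apply: eq_bigr => b _.
Qed.

Lemma casimir_add f g : regular f -> regular g ->
  casimir (f \+ g) = casimir f \+ casimir g.
Proof.
move=> rf rg; apply/funext => rho; rewrite /casimir /= -big_split /=.
apply: eq_bigr => a _; rewrite -big_split /=; apply: eq_bigr => b _.
by rewrite !deriv_fun_add //; apply: regular_deriv_fun.
Qed.

(** Trace polynomials are invariant, hence killed by every D_ab, so the Leibniz rule makes each D_ab
    linear over them. *)
Lemma casimir_trmul t f : trpoly t -> regular f ->
  casimir (t \* f) = t \* casimir f.
Proof.
move=> /trpoly_charfun[rt vt] rf; apply/funext => rho; rewrite /casimir /= mulr_sumr.
apply: eq_bigr => a _; rewrite mulr_sumr; apply: eq_bigr => b _.
have Dt a' b' h : regular h -> D a' b' (t \* h) = t \* D a' b' h.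
  move=> rh; rewrite deriv_fun_mul // deriv_fun_invariant //; apply/funext => {}rho.
  by rewrite /= mul0r add0r.
by rewrite !Dt //; apply: regular_deriv_fun.
Qed.

Lemma casimir_invariant f : regular f -> SLinvariant f -> casimir f = fun=> 0.
Proof.
move=> rf vf; apply/funext => rho; rewrite /casimir big1 // => a _.
by rewrite big1 // => b _; rewrite (deriv_fun_invariant charF _ _ rf vf) deriv_fun_cst.
Qed.

Definition mx_act d (m : 'I_#|{: mindex d}| -> F) p (M : 'M[F]_#|{: mindex d}|) : F :=
  \sum_q M p q * m q.

Lemma mx_act_sub d (m : 'I_#|{: mindex d}| -> F) p M M' :
  mx_act m p (M - M') = mx_act m p M - mx_act m p M'.
Proof. by rewrite -sumrB; apply: eq_bigr => q _; rewrite !mxE mulrBl. Qed.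

Lemma mx_act_add d (m : 'I_#|{: mindex d}| -> F) p M M' :
  mx_act m p (M + M') = mx_act m p M + mx_act m p M'.
Proof. by rewrite -big_split; apply: eq_bigr => q _; rewrite !mxE mulrDl. Qed.

Lemma mx_act_sum d (m : 'I_#|{: mindex d}| -> F) p I (r : seq I) M :
  mx_act m p (\sum_(i <- r) M i) = \sum_(i <- r) mx_act m p (M i).
Proof.
rewrite exchange_big; apply: eq_bigr => q _.
by rewrite summxE mulr_suml.
Qed.

Lemma mx_act_mul d (m : 'I_#|{: mindex d}| -> F) p M M' :
  mx_act m p (M *m M') = mx_act (mx_act m ^~ M') p M.
Proof.
rewrite /mx_act; under [RHS]eq_bigr do rewrite mulr_sumr.
rewrite exchange_big; apply: eq_bigr => q _ /=.
by rewrite mxE mulr_suml; apply: eq_bigr => r _; rewrite mulrA.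
Qed.

Lemma mx_act_scale d (m : 'I_#|{: mindex d}| -> F) p c M :
  mx_act m p (c *: M) = c * mx_act m p M.
Proof. by rewrite mulr_sumr; apply: eq_bigr => q _; rewrite mxE mulrA. Qed.

Lemma casimir_mon d (x : 'I_d -> G) p rho :
  casimir (mon x (enum_val p)) rho = \sum_a \sum_b
    mx_act (fun q => mon x (enum_val q) rho) p (deriv_mx d b a *m deriv_mx d a b).
Proof.
apply: eq_bigr => a _; apply: eq_bigr => b _.
rewrite deriv_fun_mon deriv_fun_lin => [|q]; last exact: regular_mon.
by rewrite mx_act_mul; apply: eq_bigr => q _; rewrite deriv_fun_mon.
Qed.

Lemma mx_act_row_col d (x : 'I_d -> G) p a b a' b' rho :
  mx_act (fun q => mon x (enum_val q) rho) p
    (row_move_mx d F a b *m col_move_mx d F a' b') =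
  \sum_k \sum_l ((enum_val p).1 k == a)%:R * ((enum_val p).2 l == b')%:R *
    mon x (upd (enum_val p).1 k b, upd (enum_val p).2 l a') rho.
Proof.
rewrite mx_act_mul /mx_act.
under eq_bigr do rewrite (sum_col_move_mx a' b' _ (mon x ^~ rho)).
rewrite (sum_row_move_mx a b p (fun u => \sum_l (u.2 l == b')%:R *
  mon x (u.1, upd u.2 l a') rho)).
by apply: eq_bigr => k _; rewrite mulr_sumr; apply: eq_bigr => l _; rewrite mulrA.
Qed.

(** The right-hand side is that of [mx_act_row_col]: row moves commute with column moves. *)
Lemma mx_act_col_row d (x : 'I_d -> G) p a b a' b' rho :
  mx_act (fun q => mon x (enum_val q) rho) p
    (col_move_mx d F a' b' *m row_move_mx d F a b) =
  \sum_k \sum_l ((enum_val p).1 k == a)%:R * ((enum_val p).2 l == b')%:R *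
    mon x (upd (enum_val p).1 k b, upd (enum_val p).2 l a') rho.
Proof.
rewrite mx_act_mul /mx_act.
under eq_bigr do rewrite (sum_row_move_mx a b _ (mon x ^~ rho)).
rewrite (sum_col_move_mx a' b' p (fun u => \sum_k (u.1 k == a)%:R *
  mon x (upd u.1 k b, u.2) rho)) exchange_big.
apply: eq_bigr => k _; rewrite mulr_sumr; apply: eq_bigr => l _.
by rewrite mulrA [X in X * _]mulrC.
Qed.

(** Only the products of a row move with a column move survive the subtraction. Exchanging a and b
    identifies the two orders, whence the factor 2, and the sum over the new common index a is a
    contraction. *)
Lemma casimir_mon_top d (x : 'I_d.+1 -> G) p : (forall k, S (x k)) ->
  deg_le d (fun rho => casimir (mon x (enum_val p)) rho -
    mx_act (fun q => mon x (enum_val q) rho) p (casimir_mx n d.+1 F)).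
Proof.
move=> xS; pose I := (enum_val p).1; pose J := (enum_val p).2.
have -> : (fun rho => casimir (mon x (enum_val p)) rho -
    mx_act (fun q => mon x (enum_val q) rho) p (casimir_mx n d.+1 F)) =
  fun rho => \sum_k \sum_l \sum_b (- (2 * (I k == b)%:R * (J l == b)%:R)) *
     \sum_a mon x (upd I k a, upd J l a) rho.
  apply/funext => rho; rewrite casimir_mon /casimir_mx.
  rewrite mx_act_sum -sumrB; under eq_bigr do rewrite mx_act_sum -sumrB.
  pose E a b := \sum_k \sum_l ((I k == b)%:R * (J l == b)%:R *
    mon x (upd I k a, upd J l a) rho).
  transitivity (\sum_a \sum_b - (E a b + E b a)).
    apply: eq_bigr => a _; apply: eq_bigr => b _.
    rewrite /deriv_mx mulmxBl !mulmxBr !(mx_act_sub, mx_act_add).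
    by rewrite mx_act_row_col mx_act_col_row -/(E a b) -/(E b a); ring.
  transitivity (\sum_a \sum_b - (2 * E a b)).
    under eq_bigr do rewrite sumrN big_split /=.
    rewrite sumrN big_split /= [X in _ + X]exchange_big /= -mulr2n -[X in - X]mulr_natl.
    rewrite mulr_sumr -sumrN; apply: eq_bigr => a _.
    by rewrite mulr_sumr -sumrN.
  rewrite exchange_big.
  under eq_bigr do under eq_bigr do rewrite /E mulr_sumr -sumrN.
  under eq_bigr do rewrite exchange_big /=.
  rewrite exchange_big; apply: eq_bigr => k _ /=.
  under eq_bigr do under eq_bigr do rewrite mulr_sumr -sumrN.
  under eq_bigr do rewrite exchange_big /=.
  rewrite exchange_big; apply: eq_bigr => l _ /=.
  apply: eq_bigr => b _; rewrite mulr_sumr; apply: eq_bigr => a _.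
  by ring.
do 3!apply: deg_le_sum => ? _.
apply: deg_le_trmul; first exact: trpoly_cst.
exact: deg_le_contract.
Qed.

Lemma deg_le_casimir d f : deg_le d f -> deg_le d (casimir f).
Proof.
elim=> [e x u t ed xS tt|{}f g rf IHf rg IHg]; last first.
  rewrite (casimir_add (deg_le_regular rf) (deg_le_regular rg)).
  exact: deg_le_add.
rewrite (casimir_trmul tt (regular_mon x u)).
apply: deg_le_trmul => //; rewrite -[u]enum_rankK.
have -> : casimir (mon x (enum_val (enum_rank u))) = fun rho =>
    \sum_a \sum_b \sum_q (deriv_mx e b a *m deriv_mx e a b) (enum_rank u) q *
    mon x (enum_val q) rho by apply/funext => rho; rewrite casimir_mon.
apply: deg_le_sum => a _; apply: deg_le_sum => b _; apply: deg_le_sum => q _.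
apply: deg_le_trmul; first exact: trpoly_cst.
have -> : mon x (enum_val q) = fun rho => 1 * mon x (enum_val q) rho.
  by apply/funext => rho; rewrite mul1r.
by apply: deg_le_mon => //; apply: trpoly_cst.
Qed.

Lemma deg_le_iter_casimir d f j : deg_le d f -> deg_le d (iter j casimir f).
Proof. by move=> rf; elim: j => //= j; apply: deg_le_casimir. Qed.

(** With C the operator and L its leading matrix, C^(j+1) m - L^(j+1) m = C (C^j m - L^j m) + L^j (C
    m - L m), and C preserves the filtration. *)
Lemma iter_casimir_mon_top d (x : 'I_d.+1 -> G) p j : (forall k, S (x k)) ->
  deg_le d (fun rho => iter j casimir (mon x (enum_val p)) rho -
    mx_act (fun q => mon x (enum_val q) rho) p (casimir_mx n d.+1 F ^+ j)).
Proof.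
move=> xS; elim: j => [|j IH].
  have -> : (fun rho => iter 0 casimir (mon x (enum_val p)) rho -
    mx_act (fun q => mon x (enum_val q) rho) p (casimir_mx n d.+1 F ^+ 0)) = fun=> 0.
    apply/funext => rho; rewrite expr0 /mx_act (bigD1 p) //= big1 => [|q qp].
      by rewrite mxE eqxx mul1r addr0 subrr.
    by rewrite mxE eq_sym (negPf qp) mul0r.
  exact/deg_le_trpoly/trpoly_cst.
set h := iter j casimir _ in IH *.
pose L := casimir_mx n d.+1 F.
pose g rho := mx_act (fun q => mon x (enum_val q) rho) p (L ^+ j).
have rg : regular g.
  apply: regular_sum => q; apply: regularM; first exact: regular_cst.
  exact: regular_mon.
have rh : regular (fun rho => h rho - g rho) := deg_le_regular IH.
have -> : (fun rho => iter j.+1 casimir (mon x (enum_val p)) rho -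
    mx_act (fun q => mon x (enum_val q) rho) p (L ^+ j.+1)) =
  fun rho => casimir (fun rho => h rho - g rho) rho +
    \sum_q (L ^+ j) p q * (casimir (mon x (enum_val q)) rho -
      mx_act (fun q => mon x (enum_val q) rho) q L).
  apply/funext => rho; rewrite iterS -/h.
  have {1}-> : h = (fun rho => h rho - g rho) \+ g.
    by apply/funext => rho' /=; rewrite subrK.
  rewrite casimir_add //= -addrA; congr (_ + _).
  have -> : casimir g rho = \sum_q (L ^+ j) p q * casimir (mon x (enum_val q)) rho.
    by rewrite /g /mx_act casimir_lin // => q; apply: regular_mon.
  rewrite exprSr -mulmxE mx_act_mul [X in _ - X]/mx_act -sumrB.
  by apply: eq_bigr => q _; rewrite mulrBr.
apply: deg_le_add; first exact: deg_le_casimir.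
apply: deg_le_sum => q _; apply: deg_le_trmul; first exact: trpoly_cst.
exact: casimir_mon_top.
Qed.

(** The leading matrix does not depend on the group elements in a monomial, so one annihilating
    polynomial kills the leading part of all monomials of degree d + 1 and leaves errors of degree
    at most d. *)
Lemma deg_le_annihilate d : exists2 c : {poly F}, c`_0 != 0 &
  forall f, deg_le d.+1 f ->
    deg_le d (fun rho => \sum_(j < size c) c`_j * iter j casimir f rho).
Proof.
have [c c0 cL] := annihilating_poly charF
  (fun w => @casimir_mx_inj n d.+1 w (ltn0Sn d)).
exists c => // f; elim=> [e x u t + xS tt|{}f g rf IHf rg IHg]; last first.
  have E j : iter j casimir (f \+ g) = iter j casimir f \+ iter j casimir g.
    elim: j => //= j ->; apply: casimir_add.
      exact: deg_le_regular (deg_le_iter_casimir j rf).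
    exact: deg_le_regular (deg_le_iter_casimir j rg).
  under eq_fun do under eq_bigr do rewrite -/(f \+ g) E mulrDr.
  by under eq_fun do rewrite big_split /=; apply: deg_le_add.
have E j : iter j casimir (t \* mon x u) = t \* iter j casimir (mon x u).
  elim: j => //= j ->; rewrite casimir_trmul //.
  by elim: j => [|j IHj] /=; [exact: regular_mon | exact: regular_casimir].
under eq_fun do under eq_bigr do rewrite -/(t \* mon x u) E /= mulrCA.
under eq_fun do rewrite -mulr_sumr.
move=> ed; apply: deg_le_trmul => //; move: ed.
rewrite leq_eqVlt => /predU1P[ed|]; last first.
  rewrite ltnS => ed; apply: deg_le_sum => j _.
  apply: deg_le_trmul; first exact: trpoly_cst.
  apply: deg_le_iter_casimir.
  have -> : mon x u = fun rho => 1 * mon x u rho.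
    by apply/funext => rho; rewrite mul1r.
  by apply: deg_le_mon => //; apply: trpoly_cst.
case: _ / (esym ed) x u xS E => x u xS _; rewrite -[u]enum_rankK.
pose L := casimir_mx n d.+1 F.
have -> : (fun rho => \sum_(j < size c) c`_j *
    iter j casimir (mon x (enum_val (enum_rank u))) rho) =
  fun rho => \sum_(j < size c) c`_j *
    (iter j casimir (mon x (enum_val (enum_rank u))) rho -
     mx_act (fun q => mon x (enum_val q) rho) (enum_rank u) (L ^+ j)).
  apply/funext => rho; apply/eqP; rewrite -subr_eq0 -sumrB; apply/eqP.
  under eq_bigr do rewrite -mulrBr opprB addrCA subrr addr0 -mx_act_scale.
  rewrite -mx_act_sum /L -(map_casimir_mx n d.+1 F) cL.
  by rewrite /mx_act big1 // => q _; rewrite mxE mul0r.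
apply: deg_le_sum => j _; apply: deg_le_trmul; first exact: trpoly_cst.
exact: iter_casimir_mon_top.
Qed.

(* On an invariant function the Casimir operator vanishes, so the annihilating
   polynomial acts as its nonzero constant term and lowers the degree. *)
Lemma deg_le_invariant_descent d f : deg_le d f -> SLinvariant f -> trpoly f.
Proof.
elim: d => [/deg_le0_trpoly //|d IH] rf vf; apply: IH => //.
have [c c0 cP] := deg_le_annihilate d.
have -> : f = fun rho => (c`_0)^-1 * \sum_(j < size c) c`_j * iter j casimir f rho.
  apply/funext => rho.
  have sc : (0 < size c)%N.
    by rewrite lt0n; apply: contraNneq c0 => s0; rewrite nth_default ?s0.
  rewrite (bigD1 (Ordinal sc)) //= big1 ?addr0 => [|[[|j] hj] // _].
    by rewrite mulKf.
  have -> : iter j.+1 casimir f = fun=> 0; last by rewrite mulr0.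
  elim: j {hj} => [|j IHj].
    exact: casimir_invariant (deg_le_regular rf) vf.
  rewrite iterS IHj.
  by apply: casimir_invariant => //; apply: regular_cst.
by apply: deg_le_trmul (cP f rf); apply: trpoly_cst.
Qed.

Definition deg_finite f := exists d, deg_le d f.

Lemma deg_finite_cst c : deg_finite (fun=> c).
Proof. by exists 0%N; apply/deg_le_trpoly/trpoly_cst. Qed.

Lemma deg_finite_add f g : deg_finite f -> deg_finite g ->
  deg_finite (fun rho => f rho + g rho).
Proof.
move=> [d rf] [e rg]; exists (d + e)%N; apply: deg_le_add.
  exact: deg_le_trans (leq_addr _ _) rf.
exact: deg_le_trans (leq_addl _ _) rg.
Qed.

Lemma deg_finite_mul f g : deg_finite f -> deg_finite g ->
  deg_finite (fun rho => f rho * g rho).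
Proof. by move=> [d rf] [e rg]; exists (d + e)%N; apply: deg_le_mul. Qed.

Lemma deg_finite_sum I (r : seq I) (P : pred I) (f : I -> rep -> F) :
  (forall i, deg_finite (f i)) -> deg_finite (fun rho => \sum_(i <- r | P i) f i rho).
Proof.
move=> rf; elim: r => [|i r IH].
  by under eq_fun do rewrite big_nil; apply: deg_finite_cst.
under eq_fun do rewrite big_cons; case: (P i) => //.
exact: deg_finite_add.
Qed.

Lemma deg_finite_prod I (r : seq I) (P : pred I) (f : I -> rep -> F) :
  (forall i, deg_finite (f i)) -> deg_finite (fun rho => \prod_(i <- r | P i) f i rho).
Proof.
move=> rf; elim: r => [|i r IH].
  by under eq_fun do rewrite big_nil; apply: deg_finite_cst.
under eq_fun do rewrite big_cons; case: (P i) => //.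
exact: deg_finite_mul.
Qed.

Hypothesis genS : generates S.

(** Elements outside [S] are reached through products and inverses. Entries of inverses are
    cofactors, so the degree may grow but stays finite. *)
Lemma deg_finite_entry x i j : deg_finite (fun rho => rho x i j).
Proof.
pose H : set G := fun x => forall i j, deg_finite (fun rho => rho x i j).
suff : H = setT by move=> HT; have : H x by rewrite HT.
apply: genS => [|s Ss k l]; last by exists 1%N; apply: deg_le_entry.
split=> [k l|y z Hy Hz k l|y Hy k l].
- by under eq_fun do rewrite (is_SLrep1 (SLrep_is_SLrep _)); apply: deg_finite_cst.
- under eq_fun do rewrite SLrepM mxE.
  by apply: deg_finite_sum => m; apply: deg_finite_mul.
under eq_fun do rewrite (is_SLrepV (SLrep_is_SLrep _)) mxE.
apply: deg_finite_mul; first exact: deg_finite_cst.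
apply: deg_finite_sum => s; apply: deg_finite_mul; first exact: deg_finite_cst.
apply: deg_finite_prod => m.
by under eq_fun do rewrite !mxE; apply: Hy.
Qed.

Lemma deg_finite_regular f : regular f -> deg_finite f.
Proof.
elim=> [c|x i j|{}f g _ rf _ rg|{}f g _ rf _ rg].
- exact: deg_finite_cst.
- exact: deg_finite_entry.
- exact: deg_finite_add.
- exact: deg_finite_mul.
Qed.

Theorem charfun_trpoly (f : charfun F n G) : trpoly f.
Proof.
have /asboolP[/deg_finite_regular[d rf] vf] := charfunP f.
exact: deg_le_invariant_descent rf vf.
Qed.

End Traces.

(** * Extension of homomorphisms to finitely generated rings *)

Section Extension.
Local Open Scope ring_scope.

Definition horner_map (R : comNzRingType) (K : fieldType)
    (phi : {rmorphism R -> K}) (y : K) : {rmorphism {poly R} -> K} :=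
  horner_morph (fun x => mulrC y (phi x)).

Lemma horner_mapE (R : comNzRingType) (K : fieldType) (phi : {rmorphism R -> K}) y h :
  horner_map phi y h = (map_poly phi h).[y].
Proof. by []. Qed.

(** Over a ring, each step multiplies [h] by the leading coefficient of [g] before cancelling the
    top term. *)
Lemma pseudo_division (R : comNzRingType) (g h : {poly R}) : (0 < size g)%N ->
  exists k q r, lead_coef g ^+ k *: h = q * g + r /\ (size r < size g)%N.
Proof.
move=> g0; have [N] := ubnP (size h); elim: N h => // N IH h hN.
have [hg|gh] := ltnP (size h) (size g).
  by exists 0%N, 0, h; rewrite expr0 scale1r mul0r add0r.
pose d := (size h - size g)%N.
pose h1 := lead_coef g *: h - (lead_coef h *: 'X^d) * g.
have sh1 : (size h1 < size h)%N.
  have h0 : (0 < size h)%N by apply: leq_trans gh.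
  rewrite -(prednK h0) ltnS; apply/leq_sizeP => j.
  rewrite leq_eqVlt => /predU1P[<-|hj].
    rewrite coefB coefZ -scalerAl coefZ mulrC coefXnM -/(lead_coef h).
    have dlt : ((size h).-1 < d)%N = false.
      by apply/negbTE; move: g0 gh h0; rewrite /d; lia.
    rewrite dlt; have -> : ((size h).-1 - d = (size g).-1)%N.
      by rewrite /d; move: gh g0; lia.
    by rewrite lead_coefE subrr.
  rewrite prednK // in hj.
  have sz1 : (size (lead_coef g *: h) <= size h)%N by apply: size_scale_leq.
  rewrite coefB (nth_default _ (leq_trans sz1 hj)) sub0r -scalerAl coefZ coefXnM.
  case: ifP => [|_]; first by rewrite mulr0 oppr0.
  have gjd : (size g <= j - d)%N by rewrite /d; move: gh hj; lia.
  by rewrite (nth_default 0 gjd) mulr0 oppr0.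
have [k [q [r [E sr]]]] := IH h1 (leq_trans sh1 hN).
exists k.+1, (q + lead_coef g ^+ k *: (lead_coef h *: 'X^d)), r; split => //.
rewrite exprSr -scalerA.
have -> : lead_coef g *: h = h1 + (lead_coef h *: 'X^d) * g by rewrite subrK.
by rewrite scalerDr E mulrDl -!scalerAl addrAC.
Qed.

(** Top coefficients in the kernel of [f] are cut off, so that a nonzero image has the image of the
    leading coefficient of [w1] as its own. Maps that vanish on the kernel do not see the
    difference. *)
Lemma map_trunc (R : comNzRingType) (K : fieldType) (f : {rmorphism R -> K})
    (w : {poly R}) (w1 := take_poly (size (map_poly f w)) w) :
  [/\ (size w1 <= size w)%N, map_poly f w1 = map_poly f w,
      size w1 = size (map_poly f w) &
      forall (L : fieldType) (phi : {rmorphism R -> L}),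
        (forall r, f r = 0 -> phi r = 0) -> map_poly phi w1 = map_poly phi w].
Proof.
have E (L : fieldType) (phi : {rmorphism R -> L}) :
    (forall r, f r = 0 -> phi r = 0) -> map_poly phi w1 = map_poly phi w.
  move=> c; apply/polyP => i; rewrite !coef_map coef_take_poly.
  case: ltnP => // hi; rewrite raddf0; apply/esym/c.
  by rewrite -coef_map nth_default.
have s1 : (size w1 <= size (map_poly f w))%N by apply: size_take_poly.
have Ef := E _ f (fun _ => id).
split => //.
  by apply: leq_trans s1 _; apply: size_poly.
by apply/eqP; rewrite eqn_leq s1 -Ef size_poly.
Qed.

Section OneVariable.
Variables (R : comNzRingType) (K : fieldType) (f : {rmorphism R -> K}) (y : K).

(** Such a [phi] amounts to a homomorphism on the subring f(R) of [K]; working with [R] avoids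
    forming that subring. *)
Definition ker_le (L : fieldType) (phi : {rmorphism R -> L}) : Prop :=
  forall r, f r = 0 -> phi r = 0.

Lemma map_poly_ker_le (L : fieldType) (phi : {rmorphism R -> L}) (h : {poly R}) :
  ker_le phi -> map_poly f h = 0 -> map_poly phi h = 0.
Proof.
move=> c h0; apply/polyP => i; rewrite coef0 coef_map; apply: c.
by rewrite -coef_map h0 coef0.
Qed.

Section Algebraic.
Variable g : {poly R}.
Hypotheses (size_g : size g = size (map_poly f g)) (g0 : (0 < size g)%N)
  (gy : horner_map f y g = 0).
Hypothesis min_g : forall h : {poly R},
  horner_map f y h = 0 -> (size (map_poly f h) < size g)%N -> map_poly f h = 0.

(* A Euclidean algorithm on [g] and [w]: by minimality of [g] it ends on a
   nonzero constant [u], which lies in the ideal [(g, w)]. *)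
Lemma nonzero_certificate_small N (w : {poly R}) :
  (size w <= N)%N -> (size w < size g)%N -> horner_map f y w != 0 ->
  exists2 u : R, f u != 0 &
    forall (L : fieldType) (phi : {rmorphism R -> L}) (xi : L),
      ker_le phi -> root (map_poly phi g) xi -> phi u != 0 ->
      (map_poly phi w).[xi] != 0.
Proof.
elim: N w => [|N IH] w0 w0N w0g w0y.
  by move: w0N w0y; rewrite leqn0 size_poly_eq0 => /eqP ->; rewrite rmorph0 eqxx.
have [] := map_trunc f w0; set w := take_poly _ w0 => w_le wE sw wphi.
have wN := leq_trans w_le w0N; have wg := leq_ltn_trans w_le w0g.
have wy : horner_map f y w != 0 by rewrite horner_mapE wE.
suff [u fu U] : exists2 u : R, f u != 0 &
    forall (L : fieldType) (phi : {rmorphism R -> L}) (xi : L),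
      ker_le phi -> root (map_poly phi g) xi -> phi u != 0 ->
      (map_poly phi w).[xi] != 0.
  by exists u => // L phi xi c r pu; rewrite -wphi //; apply: U.
rewrite -wE in sw.
clear w0N w0g w0y w_le wE wphi.
have [w1|w1] := leqP (size w) 1.
  exists w`_0 => [|L phi xi _ _].
    by move: wy; rewrite horner_mapE {1}(size1_polyC w1) map_polyC hornerC.
  by rewrite {2}(size1_polyC w1) map_polyC hornerC.
have w_gt0 : (0 < size w)%N by apply: leq_trans w1.
have [k [q [r [E rw]]]] := pseudo_division g w_gt0.
have Ey : horner_map f y r = - (horner_map f y q * horner_map f y w).
  apply/eqP; rewrite -addr_eq0 addrC -rmorphM -rmorphD -E.
  by rewrite -mul_polyC rmorphM gy mulr0.
(* If r(y) = 0, then [r] maps to zero and q(y) = 0; but the image of [q] is nonzero and shorter than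
   [g] since [w] is not constant, against minimality. *)
have [ry|ry] := eqVneq (horner_map f y r) 0.
  have r0 : map_poly f r = 0.
    apply: min_g => //; apply: leq_ltn_trans (size_poly _ _) _.
    exact: ltn_trans wg.
  have qy : horner_map f y q = 0.
    by move/eqP: Ey; rewrite ry eq_sym oppr_eq0 mulf_eq0 (negPf wy) orbF => /eqP.
  have fE : f (lead_coef w) ^+ k *: map_poly f g = map_poly f q * map_poly f w.
    move/(congr1 (map_poly f)): E.
    by rewrite map_polyZ rmorphD rmorphM /= r0 addr0 rmorphXn.
  have fw : f (lead_coef w) != 0.
    have : lead_coef (map_poly f w) != 0.
      by rewrite lead_coef_eq0 -size_poly_eq0 -sw -lt0n.
    by rewrite !lead_coefE coef_map -sw.
  have fg0 : map_poly f g != 0 by rewrite -size_poly_eq0 -size_g -lt0n.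
  have q0 : map_poly f q != 0.
    apply: contraNneq fg0 => q0; move: fE; rewrite q0 mul0r => /eqP.
    by rewrite scaler_eq0 expf_eq0 (negPf fw) andbF.
  have fw0 : map_poly f w != 0 by rewrite -size_poly_eq0 -sw -lt0n.
  have := congr1 (fun p : {poly K} => size p) fE.
  rewrite size_scale ?expf_neq0 // -size_g size_mul // -sw => Es.
  case/eqP: q0; apply: min_g => //; rewrite Es; move: w1.
  by case: (size w) => [|[|m]] // _; rewrite !addnS ltnS leq_addr.
have rN : (size r <= N)%N by rewrite -ltnS; apply: leq_trans rw wN.
have [u fu U] := IH r rN (ltn_trans rw wg) ry.
exists u => // L phi xi c gxi pu; have := U L phi xi c gxi pu.
apply: contra => /eqP pw0; apply/eqP.
move/(congr1 (fun p => (map_poly phi p).[xi])): E.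
rewrite map_polyZ rmorphD rmorphM hornerZ hornerD hornerM pw0 mulr0 add0r.
by rewrite (rootP gxi) mulr0.
Qed.

(** Reduction modulo [g] brings [w] below the size of [g]. The remainder does not vanish at [y],
    being w(y) times a power of the nonzero leading coefficient. *)
Lemma nonzero_certificate (w : {poly R}) : horner_map f y w != 0 ->
  f (lead_coef g) != 0 -> exists2 u : R, f u != 0 &
    forall (L : fieldType) (phi : {rmorphism R -> L}) (xi : L),
      ker_le phi -> root (map_poly phi g) xi -> phi u != 0 ->
      (map_poly phi w).[xi] != 0.
Proof.
move=> wy lg; have [k [q [r [E rg]]]] := pseudo_division w g0.
have ry : horner_map f y r != 0.
  move/(congr1 (horner_map f y)): E.
  rewrite -mul_polyC !rmorphD !rmorphM gy mulr0 add0r => <-.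
  by rewrite mulf_neq0 // horner_mapE map_polyC hornerC /= rmorphXn expf_neq0.
have [u fu U] := nonzero_certificate_small (leqnn _) rg ry.
exists u => // L phi xi c gxi pu; have := U L phi xi c gxi pu.
apply: contra => /eqP pw0; apply/eqP.
move/(congr1 (fun p => (map_poly phi p).[xi])): E.
rewrite map_polyZ rmorphD rmorphM hornerZ hornerD hornerM pw0 mulr0.
by rewrite (rootP gxi) mulr0 add0r.
Qed.

End Algebraic.

Lemma extend_one_variable (w : {poly R}) : horner_map f y w != 0 ->
  exists2 u : R, f u != 0 &
    forall (L : closedFieldType) (phi : {rmorphism R -> L}),
      ker_le phi -> phi u != 0 ->
      exists xi : L, (forall h, horner_map f y h = 0 -> horner_map phi xi h = 0)
                  /\ horner_map phi xi w != 0.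
Proof.
move=> wy.
(* If [y] is transcendental over f(R), [u] is the coefficient of [w] that maps to the leading
   coefficient of its image, and [xi] is any non-root of the image of [w] under [phi]. *)
have [tr|] := pselect (forall h, horner_map f y h = 0 -> map_poly f h = 0).
  exists w`_(size (map_poly f w)).-1 => [|L phi c pu].
    rewrite -coef_map -lead_coefE lead_coef_eq0.
    by apply: contraNneq wy => w0; rewrite horner_mapE w0 horner0.
  have pw : map_poly phi w != 0.
    apply: contraNneq pu => w0.
    by rewrite -coef_map w0 coef0.
  have [xi pxi] := closed_nonrootP _ pw.
  exists xi; split => // h /tr h0.
  by rewrite horner_mapE (map_poly_ker_le c) // horner0.
(* If [y] is algebraic, [g] is a relation of least degree, playing the role of a minimal polynomial,
   and [xi] is a root of its image. The factor [lead_coef g] in [u] keeps the degree of [g] under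
   [phi], so a root exists and pseudo-division by [g] transfers all relations. *)
move=> /existsNP[g1 /not_implyP[g1y /eqP g10]].
have ex : exists m, `[< exists h, [/\ horner_map f y h = 0,
    map_poly f h != 0 & size (map_poly f h) = m] >].
  by exists (size (map_poly f g1)); apply/asboolP; exists g1.
case: (ex_minnP ex) => m /asboolP[h0 [h0y h00 h0m]] minm.
have [] := map_trunc f h0; set g := take_poly _ h0 => _ gE sg _.
have gm : size g = m by rewrite sg.
have gy : horner_map f y g = 0 by rewrite horner_mapE gE.
have g_gt0 : (0 < size g)%N by rewrite gm -h0m size_poly_gt0.
have min_g h : horner_map f y h = 0 -> (size (map_poly f h) < size g)%N ->
    map_poly f h = 0.
  move=> hy hs; apply/eqP/negPn/negP => hn0.
  have /minm : `[< exists h', [/\ horner_map f y h' = 0, map_poly f h' != 0 &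
    size (map_poly f h') = size (map_poly f h)] >] by apply/asboolP; exists h.
  by rewrite leqNgt -gm hs.
have sgf : size g = size (map_poly f g) by rewrite sg gE.
have lg : f (lead_coef g) != 0.
  have : lead_coef (map_poly f g) != 0 by rewrite lead_coef_eq0 gE.
  by rewrite !lead_coefE coef_map -sgf.
have [u fu U] := nonzero_certificate sgf g_gt0 gy min_g wy lg.
exists (lead_coef g * u) => [|L phi c]; first by rewrite rmorphM mulf_neq0.
rewrite rmorphM mulf_eq0 negb_or => /andP[plg pu].
have sgphi : size (map_poly phi g) = size g.
  by apply: size_poly_eq; rewrite -lead_coefE.
have /closed_rootP[xi gxi] : size (map_poly phi g) != 1%N.
  rewrite sgphi; apply/eqP => g1s.
  move: gy lg; rewrite horner_mapE [g]size1_polyC ?g1s // map_polyC hornerC.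
  by rewrite lead_coefC => ->; rewrite eqxx.
exists xi; split; last exact: (U L phi xi c gxi pu).
move=> h hy; have [k [q [r [E rg]]]] := pseudo_division h g_gt0.
have ry : horner_map f y r = 0.
  move/(congr1 (horner_map f y)): E.
  by rewrite -mul_polyC rmorphD !rmorphM hy gy !mulr0 add0r.
have r0 : map_poly f r = 0.
  by apply: min_g => //; apply: leq_ltn_trans (size_poly _ _) rg.
move/(congr1 (horner_map phi xi)): E.
rewrite -mul_polyC rmorphD !rmorphM /= !horner_mapE (map_poly_ker_le c r0).
rewrite horner0 (rootP gxi) mulr0 addr0 map_polyC hornerC /= => /eqP.
by rewrite mulf_eq0 rmorphXn expf_eq0 (negPf plg) andbF => /eqP.
Qed.

End OneVariable.

(* The image of [f'] is the ring generated by [ys] over the image of [f]; only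
   the fact that it contains [ys] is recorded. *)
Lemma extend_finitely_generated (K : fieldType) (ys : seq K) :
  forall (R : comNzRingType) (f : {rmorphism R -> K}),
  exists (R' : comNzRingType) (f' : {rmorphism R' -> K})
    (j : {rmorphism R -> R'}),
  [/\ forall r, f' (j r) = f r,
      {in ys, forall y, exists r, f' r = y} &
      forall w, f' w != 0 -> exists2 u : R, f u != 0 &
        forall (L : closedFieldType) (phi : {rmorphism R -> L}),
        ker_le f phi -> phi u != 0 ->
        exists phi' : {rmorphism R' -> L},
          [/\ forall r, phi' (j r) = phi r, ker_le f' phi' & phi' w != 0]].
Proof.
elim: ys => [|y ys IH] R f.
  exists R, f, idfun; split=> // w fw; exists w => // L phi c pw.
  by exists phi.
(* The element [y] is adjoined first, as the variable of R[X], and the other [ys] over R[X]; the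
   certificates are then chained back to [R]. *)
have [R' [f' [j [jE ysE X]]]] := IH _ (horner_map f y).
exists R', f', (j \o polyC); split => [r|z|w fw].
- by rewrite /= jE horner_mapE map_polyC hornerC.
- rewrite inE => /predU1P[->|/ysE//]; exists (j 'X).
  by rewrite jE horner_mapE map_polyX hornerX.
have [v fv V] := X w fw; have [u fu U] := extend_one_variable fv.
exists u => // L phi c pu; have [xi [cx pv]] := U L phi c pu.
have [phi' [p1 p2 p3]] := V L (horner_map phi xi) cx pv.
exists phi'; split => // r.
by rewrite /= p1 horner_mapE map_polyC hornerC.
Qed.

End Extension.

(** * Ultraproducts *)

Section FieldOfRing.
Local Open Scope ring_scope.

Lemma comring_field (Q : comNzRingType) :
  (forall q : Q, exists q', q != 0 -> q' * q = 1) ->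
  exists (K : fieldType) (k : {rmorphism Q -> K}), forall x, k x = 0 -> x = 0.
Proof.
move=> invP; have [inv0 inv0P] := choice invP.
pose inv (q : Q) := if q == 0 then 0 else inv0 q.
have mulVf (q : Q) : q != 0 -> inv q * q = 1.
  by rewrite /inv => q0; rewrite (negPf q0); apply: inv0P.
have inv_0 : inv 0 = 0 by rewrite /inv eqxx.
pose K : fieldType := HB.pack (GRing.ComNzRing.sort Q)
  (GRing.ComNzRing_isField.Build Q mulVf inv_0).
by exists K, (idfun : {rmorphism Q -> Q}).
Qed.

End FieldOfRing.

Section ProductRing.
Local Open Scope ring_scope.
Variables (I : Type) (i0 : I) (L : I -> fieldType).

(* The index [i0] witnesses that the product is a nontrivial ring. *)
Definition prodring := let _ := i0 in forall i, L i.

HB.instance Definition _ := gen_eqMixin prodring.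
HB.instance Definition _ := gen_choiceMixin prodring.

Let zero : prodring := fun i => 0.
Let one : prodring := fun i => 1.
Let opp (x : prodring) : prodring := fun i => - x i.
Let add (x y : prodring) : prodring := fun i => x i + y i.
Let mul (x y : prodring) : prodring := fun i => x i * y i.

Let addA : associative add.
Proof. by move=> x y z; apply/functional_extensionality_dep => i; apply: addrA. Qed.
Let addC : commutative add.
Proof. by move=> x y; apply/functional_extensionality_dep => i; apply: addrC. Qed.
Let add0 : left_id zero add.
Proof. by move=> x; apply/functional_extensionality_dep => i; apply: add0r. Qed.
Let addN : left_inverse zero opp add.
Proof. by move=> x; apply/functional_extensionality_dep => i; apply: addNr. Qed.
HB.instance Definition _ := GRing.isZmodule.Build prodring addA addC add0 addN.

Let mulA : associative mul.
Proof. by move=> x y z; apply/functional_extensionality_dep => i; apply: mulrA. Qed.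
Let mulC : commutative mul.
Proof. by move=> x y; apply/functional_extensionality_dep => i; apply: mulrC. Qed.
Let mul1 : left_id one mul.
Proof. by move=> x; apply/functional_extensionality_dep => i; apply: mul1r. Qed.
Let mulDl : left_distributive mul +%R.
Proof. by move=> x y z; apply/functional_extensionality_dep => i; apply: mulrDl. Qed.
Let one_neq0 : one != 0.
Proof.
by apply/negP => /eqP/(congr1 (fun x : prodring => x i0))/eqP; rewrite oner_eq0.
Qed.
HB.instance Definition _ :=
  GRing.Zmodule_isComNzRing.Build prodring mulA mulC mul1 mulDl one_neq0.

Definition prodproj i (x : prodring) : L i := x i.

Lemma prodring_eq (x y : prodring) :
  (forall i, prodproj i x = prodproj i y) -> x = y.
Proof. exact: functional_extensionality_dep. Qed.

HB.instance Definition _ i := GRing.isZmodMorphism.Build prodring (L i)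
  (prodproj i) (fun _ _ => erefl).
HB.instance Definition _ i := GRing.isMonoidMorphism.Build prodring (L i)
  (prodproj i) (erefl, fun _ _ => erefl).

Section Pairing.
Variables (A : comNzRingType) (phi : forall i, {rmorphism A -> L i}).

Definition prodmap (a : A) : prodring := fun i => phi i a.

Let prodmapB : zmod_morphism prodmap.
Proof. by move=> a b; apply: prodring_eq => i; apply: rmorphB. Qed.

Let prodmapM : monoid_morphism prodmap.
Proof.
split=> [|a b]; apply: prodring_eq => i; first exact: rmorph1.
exact: rmorphM.
Qed.

HB.instance Definition _ := GRing.isZmodMorphism.Build A prodring prodmap prodmapB.
HB.instance Definition _ := GRing.isMonoidMorphism.Build A prodring prodmap prodmapM.

End Pairing.

Section Ultraproduct.
Variable U : set_system I.
Hypothesis ultraU : UltraFilter U.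

Definition ultra_pred : {pred prodring} :=
  fun x => `[< U (fun i => x i = 0) >].

Let ultra_idealr : idealr_closed ultra_pred.
Proof.
split=> [||a x y /asboolP xU /asboolP yU].
- by apply/asboolP; apply: filterS filterT.
- apply/negP => /asboolP H; apply: (@filter_not_empty _ U).
  by apply: filterS H => i /eqP; rewrite oner_eq0.
- apply/asboolP; apply: filterS (filterI xU yU) => i [xi yi].
  by rewrite -[LHS]/(a i * x i + y i) xi yi mulr0 addr0.
Qed.
HB.instance Definition _ := isIdealr.Build prodring ultra_pred ultra_idealr.

(** A family outside the ideal is nonzero on a set of the ultrafilter, and there its pointwise
    inverse is an inverse; hence the quotient is a field. *)
Lemma ultraproduct_field : exists (K : fieldType) (k : {rmorphism prodring -> K}),
  forall x, k x = 0 -> U (fun i => x i = 0).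
Proof.
pose Q : comNzRingType := {ideal_quot ultra_pred}.
pose pi : {rmorphism prodring -> Q} := \pi_Q%qT.
have piE (x : prodring) : (pi x == 0) = (x \in ultra_pred).
  by rewrite -(rmorph0 pi) -[x in RHS]subr0 Quotient.idealrBE.
have invP (q : Q) : exists q', q != 0 -> q' * q = 1.
  have [x <-] : exists x, pi x = q by exists (repr q); apply: reprK.
  have [_|x0] := eqVneq (pi x) 0; first by exists 0.
  exists (pi (fun i => (x i)^-1)) => _; rewrite -rmorphM -(rmorph1 pi).
  apply/eqP; rewrite -subr_eq0 -rmorphB piE; apply/asboolP.
  have [x0U|] := in_ultra_setVsetC (fun i => x i = 0) ultraU.
    by move: x0; rewrite piE => /asboolP.
  apply: filterS => i /= /eqP xi.
  by rewrite -[LHS]/((x i)^-1 * x i - 1) mulVf // subrr.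
have [K [k kinj]] := comring_field invP.
by exists K, (k \o pi) => x /kinj /eqP; rewrite piE => /asboolP.
Qed.

End Ultraproduct.
End ProductRing.

(** * Pulling back representations *)

Section Transport.
Local Open Scope ring_scope.

(** The sets of indices at which [a] survives are nonempty, as [a] is itself an index, and the one
    for ab lies in those for a and b. They generate a proper filter, and any ultrafilter above it
    will do. *)
Lemma separating_ultraproduct (A : comNzRingType) (F : fieldType)
    (f : {rmorphism A -> F}) (L : {w | f w != 0} -> fieldType)
    (phi : forall i, {rmorphism A -> L i}) (i0 : {w | f w != 0}) :
  (forall i, phi i (val i) != 0) ->
  exists (K : fieldType) (k : {rmorphism prodring i0 L -> K}),
    forall a, f a != 0 -> k (prodmap i0 phi a) != 0.
Proof.
move=> phi_neq0.
pose B a : set {w | f w != 0} := fun i => phi i a != 0.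
pose FB := filter_from (fun a => f a != 0) B.
have FBF : Filter FB.
  apply: filter_from_filter; first by exists 1; rewrite rmorph1 oner_eq0.
  move=> a b fa fb; exists (a * b); first by rewrite rmorphM mulf_neq0.
  by move=> i; rewrite /B rmorphM mulf_eq0 negb_or => /andP[].
have FBP : ProperFilter FB.
  apply: filter_from_proper => a fa.
  by exists (exist _ a fa); apply: (phi_neq0 (exist _ a fa)).
have [U [ultraU FBU]] := ultraFilterLemma FBP.
have [K [k kU]] := ultraproduct_field i0 L ultraU.
exists K, k => a fa; apply/negP => /eqP/kU a0U.
have aU : U (B a) by apply: FBU; exists a.
apply: (@filter_not_empty _ U); apply: filterS (filterI a0U aU) => i [/= ai].
by rewrite /B -[phi i a]/(prodmap i0 phi a i) ai eqxx.
Qed.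

(** The lift [r] satisfies the identities of a representation only modulo the kernel of [f], which
    [phi] kills. *)
Lemma transported_SLrep (A : comNzRingType) (F L : fieldType)
    (f : {rmorphism A -> F}) (phi : {rmorphism A -> L}) n (G : groupType)
    (r : G -> 'M[A]_n) :
  ker_le f phi -> is_SLrep (fun x => map_mx f (r x)) ->
  is_SLrep (fun x => map_mx phi (r x)).
Proof.
move=> c [d m]; have E a b : f a = f b -> phi a = phi b.
  move=> fab; apply/eqP; rewrite -subr_eq0 -rmorphB; apply/eqP/c.
  by rewrite rmorphB fab subrr.
split=> [x|x y].
  rewrite det_map_mx -(rmorph1 phi); apply: E.
  by rewrite -det_map_mx d rmorph1.
rewrite -map_mxM; apply/matrixP => i j; rewrite !mxE; apply: E.
by have := congr1 (fun X : 'M_n => X i j) (m x y); rewrite -map_mxM !mxE.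
Qed.

Lemma lift_SLrep (A : comNzRingType) (K : fieldType) (f : {rmorphism A -> K})
    n (G : groupType) (M : G -> 'M[K]_n) (xs : seq G) :
  is_SLrep M -> generates [set` xs] ->
  (forall x i j, x \in xs -> exists a, f a = M x i j) ->
  exists r : G -> 'M[A]_n, forall x, map_mx f (r x) = M x.
Proof.
move=> repM gen H.
have R : forall x i j, exists a, f a = M x i j.
  apply: (entries_in_subring (P := fun y => exists a, f a = y) repM _ _ _ gen H).
  - by exists 1; apply: rmorph1.
  - by move=> _ _ [a <-] [b <-]; exists (a - b); apply: rmorphB.
  - by move=> _ _ [a <-] [b <-]; exists (a * b); apply: rmorphM.
exists (fun x => \matrix_(i, j) projT1 (cid (R x i j))) => x.
by apply/matrixP => i j; rewrite !mxE; case: cid.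
Qed.

Definition entries (R : nzRingType) n (G : Type) (M : G -> 'M[R]_n) (xs : seq G) :=
  [seq M x ij.1 ij.2 | x <- xs, ij <- enum {: 'I_n * 'I_n}].

Lemma mem_entries (R : nzRingType) n (G : eqType) (M : G -> 'M[R]_n) (xs : seq G)
  x i j : x \in xs -> M x i j \in entries M xs.
Proof.
by move=> xxs; apply/allpairsP; exists (x, (i, j)); split; rewrite ?mem_enum.
Qed.

Lemma exprB_pchar (R : comNzRingType) p k (x y : R) : p \in [pchar R] ->
  (x - y) ^+ (p ^ k) = x ^+ (p ^ k) - y ^+ (p ^ k).
Proof.
move=> pR; elim: k => [|k IH]; first by rewrite !expr1.
by rewrite expnSr !exprM IH -!(pFrobenius_autE pR) rmorphB.
Qed.

Section Main.
Variables (F : closedFieldType) (charF : [pchar F] =i pred0).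
Variables (G1 G2 : groupType).
Hypotheses (fgG1 : finitely_generated G1) (fgG2 : finitely_generated G2).
Variable Phi : {multiplicative profinite G1 -> profinite G2}.
Variable n : nat.

Lemma residue_SLrep (A : comNzRingType) (f : {rmorphism A -> F})
    (r : G2 -> 'M[A]_n) (L : closedFieldType) (phi : {rmorphism A -> L}) p :
  is_SLrep (fun x => map_mx f (r x)) -> ker_le f phi ->
  (p \in [pchar L]) -> (forall y : L, exists2 k, (0 < k)%N & y ^+ (p ^ k) = y) ->
  exists sigma : G1 -> 'M[L]_n, is_SLrep sigma /\
    forall s t, conjugate_to (Phi (to_profinite s)) (to_profinite t) ->
      \tr (sigma s) = phi (\tr (r t)).
Proof.
move=> repf c pL perL; have repM := transported_SLrep c repf.
set M := (fun x => _) in repM.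
have [xs gen] := fgG2.
have [k k0 kP] := common_frobenius_power (entries M xs) perL.
have Mq x i j : M x i j ^+ (p ^ k) = M x i j.
  (* In characteristic p the fixed points of the p^k-th power map form a subring, so the generators
     suffice. *)
  apply: (entries_in_subring (P := fun y => y ^+ (p ^ k) = y) repM _ _ _ gen).
  - exact: expr1n.
  - by move=> a b Pa Pb; rewrite exprB_pchar // Pa Pb.
  - by move=> a b Pa Pb; rewrite exprMn Pa Pb.
  - by move=> {}x {}i {}j xxs; apply: kP; apply: mem_entries.
have q1 : (1 < p ^ k)%N.
  by rewrite -(expn0 p) ltn_exp2l // prime_gt1 // (pcharf_prime pL).
have finM := finitely_many_matrices q1 Mq.
have repH := profinite_rep_SLrep repM finM.
exists (fun x => profinite_rep repM finM (Phi (to_profinite x))); split.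
  apply: (is_SLrep_comp (f := Phi \o @to_profinite G1) _ repH) => x y /=.
  by rewrite to_profiniteM gmulfM.
move=> s t [w E]; rewrite -(mxtrace_conj _ w repH) E profinite_rep_to.
by rewrite /M trace_map_mx.
Qed.

Theorem pullback_SLrep (rho : SLrep F n G2) : exists rho' : SLrep F n G1,
  forall s t, conjugate_to (Phi (to_profinite s)) (to_profinite t) ->
    \tr (rho' s) = \tr (rho t).
Proof.
have repR := SLrep_is_SLrep rho.
have [xs2 gen2] := fgG2; have [xs1 gen1] := fgG1.
have [A [f [j [fj ysA X]]]] :=
  extend_finitely_generated (entries rho xs2) (intr : {rmorphism int -> F}).
have [r rE] := lift_SLrep repR gen2
  (fun x i j xx => ysA _ (mem_entries rho i j xx)).
have repf : is_SLrep (fun x => map_mx f (r x)).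
  by rewrite (_ : (fun x => _) = rho) //; apply/funext.
have res (i : {w | f w != 0}) : {L : closedFieldType &
    {phi : {rmorphism A -> L} & {sigma : G1 -> 'M[L]_n |
      [/\ ker_le f phi, phi (val i) != 0, is_SLrep sigma &
      forall s t, conjugate_to (Phi (to_profinite s)) (to_profinite t) ->
      \tr (sigma s) = phi (\tr (r t))]}}}.
  suff : exists (L : closedFieldType) (phi : {rmorphism A -> L})
      (sigma : G1 -> 'M[L]_n),
      [/\ ker_le f phi, phi (val i) != 0, is_SLrep sigma &
      forall s t, conjugate_to (Phi (to_profinite s)) (to_profinite t) ->
      \tr (sigma s) = phi (\tr (r t))].
    by move=> /cid[L] /cid[phi] /cid[sigma H]; exists L, phi, sigma.
  (* Nonvanishing at the index is certified by an integer [u]. A prime above |u| keeps [u] nonzero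
     in [L], so the map from the integers extends to [A]. *)
  have [u fu U] := X _ (valP i).
  have u0 : u != 0 by apply: contraNneq fu => ->; rewrite rmorph0.
  have [p pu pp] := prime_above `|u|%N.
  have [L [pL perL]] := exists_Fpbar pp.
  have cL : ker_le (intr : {rmorphism int -> F}) (intr : {rmorphism int -> L}).
    move=> z /eqP; rewrite (intr_pchar0_eq0 charF) => /eqP ->.
    exact: rmorph0.
  have uL : u%:~R != 0 :> L.
    have : (`|u|%N%:R : L) != 0.
      rewrite -(dvdn_pcharf pL); apply/negP => /dvdn_leq; rewrite absz_gt0 u0.
      by rewrite leqNgt pu => /(_ isT).
    by case: (u) => m //; rewrite NegzE rmorphN oppr_eq0.
  have [phi [_ c phi_neq0]] := U L (intr : {rmorphism int -> L}) cL uL.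
  have [sigma [S1 S2]] := residue_SLrep repf c pL perL.
  by exists L, phi, sigma.
pose L i : fieldType := projT1 (res i).
pose phi i : {rmorphism A -> L i} := projT1 (projT2 (res i)).
pose sigma i : G1 -> 'M[L i]_n := sval (projT2 (projT2 (res i))).
have resP i : [/\ ker_le f (phi i), phi i (val i) != 0, is_SLrep (sigma i) &
  forall s t, conjugate_to (Phi (to_profinite s)) (to_profinite t) ->
  \tr (sigma i s) = phi i (\tr (r t))] by exact: (svalP (projT2 (projT2 (res i)))).
have f1 : f 1 != 0 by rewrite rmorph1 oner_eq0.
pose i0 : {w | f w != 0} := exist _ 1 f1.
have [|K [k kP]] := @separating_ultraproduct A F f L phi i0.
  by move=> i; case: (resP i).
pose M x : 'M[prodring i0 L]_n := \matrix_(i, j) (fun w => sigma w x i j).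
have ME w x : map_mx (prodproj w) (M x) = sigma w x.
  by apply/matrixP => a b; rewrite !mxE.
have repM : is_SLrep M.
  split=> [x|x y].
    apply: prodring_eq => w; rewrite -det_map_mx ME rmorph1.
    by case: (resP w) => _ _ [].
  apply/matrixP => a b; apply: prodring_eq => w.
  have := congr1 (fun X : 'M_n => X a b) (ME w (x * y)%g).
  rewrite mxE => ->; case: (resP w) => _ _ [_ ->] _.
  by rewrite -!ME -map_mxM mxE.
have trM s t : conjugate_to (Phi (to_profinite s)) (to_profinite t) ->
    \tr (M s) = prodmap i0 phi (\tr (r t)).
  move=> st; apply: prodring_eq => w; rewrite -trace_map_mx ME.
  by case: (resP w) => _ _ _ /(_ s t st) ->.
have repK : is_SLrep (fun x => map_mx k (M x)).
  split=> [x|x y]; first by rewrite det_map_mx repM.1 rmorph1.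
  by rewrite repM.2 map_mxM.
pose f2 : {rmorphism A -> K} := k \o prodmap i0 phi.
have [B [g [h [gh ysB Y]]]] :=
  extend_finitely_generated (entries (fun x => map_mx k (M x)) xs1) f2.
have [r1 r1E] := lift_SLrep repK gen1
  (fun x i j xx => ysB _ (mem_entries (fun x => map_mx k (M x)) i j xx)).
have g1 : g 1 != 0 by rewrite rmorph1 oner_eq0.
have [u f2u V] := Y 1 g1.
(* The maps [f] and [f2] have the same kernel. Hence [f] is admissible for the extension problem
   over [f2], and [u] is nonzero under it. *)
have f2f : ker_le f2 f.
  by move=> a f2a; apply/eqP; apply: contraTT (eqxx (0 : K)) => /kP; rewrite -f2a.
have ff2 : forall a, f a = 0 -> f2 a = 0.
  move=> a fa; rewrite /f2 /= (_ : prodmap i0 phi a = 0) ?rmorph0 //.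
  apply: prodring_eq => w; rewrite rmorph0.
  by case: (resP w) => c _ _ _; apply: c.
have fu : f u != 0 by apply: contraNneq f2u => /ff2 ->.
have [psi [psih c _]] := V F f f2f fu.
have repg : is_SLrep (fun x => map_mx g (r1 x)).
  by rewrite (_ : (fun x => map_mx g (r1 x)) = fun x => map_mx k (M x)) //;
    apply/funext.
have repP := transported_SLrep c repg.
exists (SLRep repP.1 repP.2) => s t st /=.
have E : g (\tr (r1 s)) = g (h (\tr (r t))).
  by rewrite gh -trace_map_mx r1E trace_map_mx (trM s t st).
rewrite trace_map_mx -rE trace_map_mx -psih; apply/eqP.
by rewrite -subr_eq0 -rmorphB; apply/eqP/c; rewrite rmorphB E subrr.
Qed.

End Main.
End Transport.

(** * The comorphism *)

Lemma multiplicative_conj (G H : groupType) (f : {multiplicative G -> H}) x y :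
  f (x ^ y)%g = (f x ^ f y)%g.
Proof. by apply: (mulgI (f y)); rewrite -conjgC -!gmulfM -conjgC. Qed.

Section Comorphism.
Local Open Scope ring_scope.
Variables (F : closedFieldType) (charF : [pchar F] =i pred0) (n : nat).

Lemma lrmorphism_traces_eq (G1 G2 : groupType) (S : set G1)
    (f g : {lrmorphism charfun F n G1 -> charfun F n G2}) :
  is_semigroup S -> generates S ->
  (forall s, S s -> f (charfun_trace F n s) = g (charfun_trace F n s)) ->
  f =1 g.
Proof.
move=> semiS genS fg.
(* Induction runs over the underlying function, which may belong to the algebra in the guise of any
   [c]. *)
suff H t : trpoly S t -> forall c : charfun F n G1, charfun_val c = t -> f c = g c.
  by move=> c; apply: H (charfun_trpoly charF semiS genS c) c erefl.
elim=> [a|s Ss|t1 t2 tt1 IH1 tt2 IH2|t1 t2 tt1 IH1 tt2 IH2] c ct.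
- have -> : c = a *: 1.
    apply: val_inj; rewrite /= ct; apply/funext => rho.
    by rewrite -[RHS]/(a * 1) mulr1.
  by rewrite !linearZ /= !rmorph1.
- have -> : c = charfun_trace F n s by apply: val_inj.
  exact: fg.
- have P1 : t1 \in @charfun_pred F n G1 by apply/asboolP/(trpoly_charfun tt1).
  have P2 : t2 \in @charfun_pred F n G1 by apply/asboolP/(trpoly_charfun tt2).
  have -> : c = CharFun P1 + CharFun P2 by apply: val_inj; rewrite /= ct.
  by rewrite (rmorphD f) (rmorphD g); congr (_ + _); [apply: IH1 | apply: IH2].
- have P1 : t1 \in @charfun_pred F n G1 by apply/asboolP/(trpoly_charfun tt1).
  have P2 : t2 \in @charfun_pred F n G1 by apply/asboolP/(trpoly_charfun tt2).
  have -> : c = CharFun P1 * CharFun P2 by apply: val_inj; rewrite /= ct.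
  by rewrite (rmorphM f) (rmorphM g); congr (_ * _); [apply: IH1 | apply: IH2].
Qed.

Lemma exists_comorphism (G1 G2 : groupType)
    (fgG1 : finitely_generated G1) (fgG2 : finitely_generated G2)
    (Phi : {multiplicative profinite G1 -> profinite G2}) :
  semiauthentic Phi ->
  exists f : {lrmorphism charfun F n G1 -> charfun F n G2},
    forall s t, conjugate_to (Phi (to_profinite s)) (to_profinite t) ->
      f (charfun_trace F n s) = charfun_trace F n t.
Proof.
move=> [S [semiS genS authS]].
have [p pE] := choice (pullback_SLrep charF fgG1 fgG2 Phi (n := n)).
(* The representations [p rho] are chosen with no regularity in rho. The composite is regular and
   invariant because [c] is a polynomial in traces at [S], and these pull back to traces. *)
have pP (c : charfun F n G1) : (fun rho => c (p rho)) \in @charfun_pred F n G2.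
  apply/asboolP; have := charfun_trpoly charF semiS genS c.
  elim=> [a|s Ss|f g _ [rf vf] _ [rg vg]|f g _ [rf vf] _ [rg vg]].
  - by split=> //; apply: regular_cst.
  - have [t st] := authS s Ss.
    have -> : (fun rho => \tr (p rho s)) = fun rho : SLrep F n G2 => \tr (rho t).
      by apply/funext => rho; apply: pE.
    exact/asboolP/charfun_traceP.
  - by split=> [|h h1 rho]; [apply: regularD | rewrite vf vg].
  - by split=> [|h h1 rho]; [apply: regularM | rewrite vf vg].
pose f c : charfun F n G2 := CharFun (pP c).
have fB : zmod_morphism f by move=> c d; apply: val_inj.
have fM : monoid_morphism f by split=> [|c d]; apply: val_inj.
have fZ : scalable f by move=> a c; apply: val_inj.
pose f' : {lrmorphism charfun F n G1 -> charfun F n G2} := HB.pack f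
  (GRing.isZmodMorphism.Build _ _ f fB) (GRing.isMonoidMorphism.Build _ _ f fM)
  (GRing.isScalable.Build _ _ _ _ f fZ).
exists f' => s t st; apply: val_inj; apply/funext => rho /=.
exact: pE.
Qed.

End Comorphism.

(** * Maximal spectra of isomorphic algebras *)

Section MaxSpecIso.
Local Open Scope ring_scope.
Variables (F : fieldType) (A B : comAlgType F).

Lemma maximal_ideal_preimage (f : {lrmorphism A -> B}) (g : B -> A)
    (m : set B) : cancel f g -> cancel g f ->
  is_maximal_ideal m -> is_maximal_ideal (f @^-1` m)%classic.
Proof.
move=> fK gK [[m0 mD mM] m1 maxm].
split=> [||I [I0 ID IM] I1 mI].
- split=> [|a b ma mb|a b mb] /=; first by rewrite rmorph0.
    by rewrite rmorphD; apply: mD.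
  by rewrite rmorphM; apply: mM.
- by rewrite /= rmorph1.
(* The image of [I] is an ideal since [f] is onto, and it contains [m]; maximality of [m] is applied
   to it. *)
pose J : set B := fun b => exists2 a, I a & f a = b.
have <- : J = m.
  apply: maxm.
  - split=> [|_ _ [a Ia <-] [b Ib <-]|c _ [b Ib <-]].
    + by exists 0; rewrite ?rmorph0.
    + by exists (a + b); rewrite ?rmorphD //; apply: ID.
    + exists (g c * b); first exact: IM.
      by rewrite (rmorphM f); congr (_ * _); apply: gK.
  - by move=> [a Ia fa]; apply: I1; rewrite -(fK 1) rmorph1 -fa fK.
  - by move=> b mb; exists (g b); rewrite ?gK //; apply: mI; rewrite /= gK.
apply/seteqP; split=> [a Ia|a [b Ib /(can_inj fK) <-] //].
by exists a.
Qed.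

Definition spec_iso (f : {lrmorphism A -> B}) (g : B -> A) (fK : cancel f g)
    (gK : cancel g f) (m : MaxSpec B) : MaxSpec A :=
  MaximalIdeal (maximal_ideal_preimage fK gK (maximal_setP m)).

End MaxSpecIso.

Lemma MaxSpec_eq (A : comNzRingType) (m m' : MaxSpec A) :
  m = m' :> set A -> m = m'.
Proof.
case: m m' => [m mP] [m' m'P] /= E; case: _ / E m'P => m'P.
by congr MaximalIdeal; apply: Prop_irrelevance.
Qed.

Theorem corollary13p13 (G1 G2 : groupType)
    (fgG1 : finitely_generated G1) (rfG1 : residually_finite G1)
    (fgG2 : finitely_generated G2) (rfG2 : residually_finite G2)
    (Phi : {multiplicative profinite G1 -> profinite G2})
    (hPhi : bi_semiauthentic_isomorphism Phi)
    (n : nat) (F : closedFieldType) (charF : [pchar F]%R =i pred0) :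
  exists Phi_star : character_variety F n G2 -> character_variety F n G1,
    induced_map Phi Phi_star /\ algebraic_isomorphism Phi_star.
Proof.
have [Psi [PhiK PsiK aPhi aPsi]] := hPhi.
have [f fE] := exists_comorphism charF n fgG1 fgG2 aPhi.
have [g gE] := exists_comorphism charF n fgG2 fgG1 aPsi.
(* Conjugacy passes through the inverse, so the same pairs (s, t) serve both comorphisms, and their
   composites fix the traces of a generating semigroup. *)
have conj_inv (H1 H2 : groupType) (X : {multiplicative profinite H1 -> profinite H2})
    (Y : {multiplicative profinite H2 -> profinite H1}) s t : cancel X Y ->
    conjugate_to (X (to_profinite s)) (to_profinite t) ->
    conjugate_to (Y (to_profinite t)) (to_profinite s).
  move=> XK [w E]; exists (Y w)^-1%g.
  have -> : Y (to_profinite t) = (to_profinite s ^ Y w)%g.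
    by rewrite -E multiplicative_conj XK.
  by rewrite -conjgM mulgV conjg1.
have fK : cancel f g.
  have [S [semiS genS authS]] := aPhi.
  apply: (@lrmorphism_traces_eq F charF n G1 G1 S (g \o f) idfun) => // s Ss.
  have [t st] := authS s Ss; rewrite /= (fE s t st).
  by apply: gE; apply: conj_inv st.
have gK : cancel g f.
  have [S [semiS genS authS]] := aPsi.
  apply: (@lrmorphism_traces_eq F charF n G2 G2 S (f \o g) idfun) => // s Ss.
  have [t st] := authS s Ss; rewrite /= (gE s t st).
  by apply: fE; apply: conj_inv st.
exists (spec_iso fK gK); split.
  exists f; split=> // S st [semiS genS stS]; split=> [s Ss|h hE].
    exact/fE/stS.
  apply: (lrmorphism_traces_eq charF semiS genS) => s Ss.
  by rewrite hE // (fE s (st s) (stS s Ss)).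
split; first by exists f.
exists (spec_iso gK fK); split; first by exists g.
- move=> m; apply: MaxSpec_eq; apply/seteqP; split=> a /=; by rewrite gK.
- move=> m; apply: MaxSpec_eq; apply/seteqP; split=> a /=; by rewrite fK.
Qed.
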